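(* Let $3\le n\le\infty$ and let $\Gamma\le\mathrm{Sym}(n)$. Suppose that the permutation group $\Gamma$ of $[n]$ is neither generously transitive nor semi-generous. Then there is a bounded $\mathbf{Z}$-valued 2-cocycle on the (abstract) kaleidoscopic group $\mathcal{K}(\Gamma)$ which determines a non-trivial class in $\mathrm{H}^2(\mathcal{K}(\Gamma),\mathbf{Z})$ and a non-trivial class in bounded cohomology $\mathrm{H}_{\mathrm b}^2(\mathcal{K}(\Gamma),\mathbf{Z})$. Moreover, these classes remain non-trivial when viewed as $\mathbf{R}$-valued cohomology classes, i.e. in $\mathrm{H}^2(\mathcal{K}(\Gamma),\mathbf{R})$ and $\mathrm{H}_{\mathrm b}^2(\mathcal{K}(\Gamma),\mathbf{R})$ respectively.
   Context: A dendrite is a locally connected continuum (non-empty compact connected metrizable space) containing no simple closed curve. Any two distinct points $x,y$ of a dendrite $X$ are joined by a unique arc $[x,y]$; put $(x,y)=[x,y]\setminus\{x,y\}$. For $x\in X$, $\widehat{x}=\pi_0(X\setminus\{x\})$ is the (at most countable) set of components of $X\setminus\{x\}$; $x$ is a branch point if $|\widehat{x}|\ge 3$, and $\mathrm{Br}(X)$ is the (at most countable) set of branch points. For $3\le n\le\infty$ ($\infty$ meaning countably infinite), the Ważewski dendrite $D_n$ is the dendrite, unique up to homeomorphism, which is not a single point, in which $|\widehat{x}|=n$ for every branch point $x$, and in which $(x,y)$ contains a branch point for all $x\ne y$. Write $[n]=\{m\in\mathbf{N}: m<n\}$ (so $[\infty]=\mathbf{N}\ni 0$) and $\mathrm{Sym}(n)$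 for the group of all permutations of $[n]$. A coloring of $D_n$ is a map $c$ from $\widehat{D_n}=\bigsqcup_{x\in\mathrm{Br}(D_n)}\widehat{x}$ to $[n]$ whose restriction $c_x=c|_{\widehat{x}}$ is a bijection $\widehat{x}\to[n]$ for each $x\in \mathrm{Br}(D_n)$; for $y\ne x$, $c_x(y)$ denotes the color of the component of $D_n\setminus\{x\}$ containing $y$. The coloring is kaleidoscopic if for all distinct $x,y\in\mathrm{Br}(D_n)$ and all distinct $i,j\in[n]$ there is $z\in(x,y)\cap\mathrm{Br}(D_n)$ with $c_z(x)=i$ and $c_z(y)=j$. For $g\in\mathrm{Homeo}(D_n)$ and $x\in\mathrm{Br}(D_n)$ put $\sigma_c(g,x)=c_{g(x)}\circ g\circ c_x^{-1}\in\mathrm{Sym}(n)$, where $g$ is viewed as a bijection $\widehat{x}\to\widehat{g(x)}$. For $\Gamma\le\mathrm{Sym}(n)$ put $\mathcal{K}_c(\Gamma)=\{g\in\mathrm{Homeo}(D_n):\sigma_c(g,x)\in\Gamma\ \text{for all } x\in\mathrm{Br}(D_n)\}$. Kaleidoscopic colorings exist and for any two of them, $c$ and $d$, the groups $\mathcal{K}_c(\Gamma)$ and $\mathcal{K}_d(\Gamma)$ are conjugate in $\mathrm{Homeo}(D_n)$; $\mathcal{K}(\Gamma)$ denotes $\mathcal{K}_c(\Gamma)$ for some (any) kaleidoscopic coloring $c$. An action of a group $G$ on a set is generously transitive if for any $x,y$ in the set there is $g\in G$ with $g(x)=y$ and $g(y)=x$. Two actions of the same group are orthogonal if the diagonal action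 on the product is transitive. An action is semi-generous if the set decomposes into exactly two orbits, these two orbits are orthogonal, and the action on each of them is generously transitive. For an abelian group $A\in\{\mathbf{Z},\mathbf{R}\}$ and an abstract group $G$, $\mathrm{H}^q(G,A)$ is the quotient of the $G$-invariant cocycles $G^{q+1}\to A$ by the coboundaries of $G$-invariant maps $G^q\to A$, for the homogeneous coboundary $(d\alpha)(x_0,\dots,x_{q+1})=\sum_j(-1)^j\alpha(\dots,\widehat{x_j},\dots)$ (omitting $x_j$); $\mathrm{H}_{\mathrm b}^q(G,A)$ is defined in the same way with all cochains required to be bounded. *)

(* Defs.v *)
From HB Require Import structures.
From mathcomp Require Import all_boot all_order all_algebra.
From mathcomp Require Import all_classical all_reals all_analysis.

Set Implicit Arguments.
Unset Strict Implicit.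
Unset Printing Implicit Defensive.

Import Order.TTheory GRing.Theory Num.Theory.
Import numFieldNormedType.Exports.

Local Open Scope classical_set_scope.
Local Open Scope ring_scope.

Record sym (T : Type) := Sym {
  sym_fun :> T -> T;
  sym_inv : T -> T;
  sym_funK : cancel sym_fun sym_inv;
  sym_invK : cancel sym_inv sym_fun }.

Section SymGroup.
Context {T : Type}.
Implicit Types f g h : sym T.

Lemma sym_eqP f g : f =1 g -> f = g.
Proof.
case: f g => [f f' fK f'K] [g g' gK g'K] /= /funext fg.
rewrite -{g}fg in gK g'K *.
have ff' : f' = g' by apply/funext => x; rewrite -{1}(g'K x) fK.
rewrite -{g'}ff' in gK g'K *.
by congr Sym; exact: Prop_irrelevance.
Qed.

Definition sym_one : sym T := @Sym T id id (fun=> erefl) (fun=> erefl).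

Definition sym_mul f g : sym T :=
  Sym (can_comp (@sym_funK T f) (@sym_funK T g))
      (can_comp (@sym_invK T g) (@sym_invK T f)).

Definition sym_V f : sym T := Sym (@sym_invK T f) (@sym_funK T f).

HB.instance Definition _ := gen_eqMixin (sym T).
HB.instance Definition _ := gen_choiceMixin (sym T).

Lemma sym_mulA : associative sym_mul.
Proof. by move=> f g h; exact: sym_eqP. Qed.
Lemma sym_mul1 : left_id sym_one sym_mul.
Proof. by move=> f; exact: sym_eqP. Qed.
Lemma sym_mulr1 : right_id sym_one sym_mul.
Proof. by move=> f; exact: sym_eqP. Qed.
Lemma sym_mulV : left_inverse sym_one sym_V sym_mul.
Proof. by move=> f; apply: sym_eqP => x /=; rewrite sym_funK. Qed.
Lemma sym_mulrV : right_inverse sym_one sym_V sym_mul.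
Proof. by move=> f; apply: sym_eqP => x /=; rewrite sym_invK. Qed.

HB.instance Definition _ :=
  isGroup.Build (sym T) sym_mulA sym_mul1 sym_mulr1 sym_mulV sym_mulrV.

End SymGroup.

Record subgroup (G : groupType) := Subgroup {
  subgroup_set : set G;
  subgroup_closed : group_closed (fun x => x \in subgroup_set) }.

Definition subgroup_sort (G : groupType) (H : subgroup G) :=
  {x : G | x \in subgroup_set H}.
Coercion subgroup_sort : subgroup >-> Sortclass.

HB.instance Definition _ (G : groupType) (H : subgroup G) :=
  SubChoice.on (subgroup_sort H).
HB.instance Definition _ (G : groupType) (H : subgroup G) :=
  SubChoice_isSubGroup.Build G _ (subgroup_sort H) (@subgroup_closed G H).

Section Topology.
Context {R : realType}.

Definition metrizable (X : topologicalType) :=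
  exists d : X -> X -> R,
    [/\ forall x y, 0 <= d x y,
        forall x y, d x y = 0 <-> x = y,
        forall x y, d x y = d y x,
        forall x y z, d x z <= d x y + d y z &
        forall x (A : set X), nbhs x A <->
          exists2 e : R, 0 < e & [set y | d x y < e] `<=` A].

Definition locally_connected (X : topologicalType) :=
  forall (x : X) (U : set X), nbhs x U ->
    exists V : set X, [/\ open V, V x, connected V & V `<=` U].

(* f restricts to a homeomorphism of the subspace A onto the subspace B *)
Definition homeo_onto (T U : topologicalType) (A : set T) (B : set U)
    (f : T -> U) :=
  exists g : U -> T,
    [/\ {within A, continuous f}, {within B, continuous g},
        (forall x, A x -> B (f x) /\ g (f x) = x) &
        (forall y, B y -> A (g y) /\ f (g y) = y)].

Definition unit_circle : set (R * R) := [set p | p.1 ^+ 2 + p.2 ^+ 2 = 1].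

Definition simple_closed_curve (X : topologicalType) (S : set X) :=
  exists f : R * R -> X, homeo_onto unit_circle S f.

Definition dendrite (X : topologicalType) :=
  [/\ [set: X] !=set0, compact [set: X], connected [set: X] & metrizable X] /\
  locally_connected X /\ ~ (exists S : set X, simple_closed_curve S).

Definition is_arc (X : topologicalType) (x y : X) (S : set X) :=
  exists f : R -> X, [/\ @homeo_onto R X `[0, 1] S f, f 0 = x & f 1 = y].

(* The arc from x to y, which is unique in a dendrite when x <> y. *)
Definition arc (X : topologicalType) (x y : X) : set X :=
  xget set0 [set S | is_arc x y S].

Definition open_arc (X : topologicalType) (x y : X) : set X :=
  arc x y `\` [set x; y].

End Topology.
Arguments metrizable R X : clear implicits.
Arguments dendrite R X : clear implicits.
Arguments arc R {X} x y.
Arguments open_arc R {X} x y.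

(* The component of X \ {x} containing y, for y <> x. *)
Definition component_at (X : topologicalType) (x y : X) : set X :=
  connected_component (~` [set x]) y.

Definition components_at (X : topologicalType) (x : X) : set (set X) :=
  component_at x @` ~` [set x].

Definition branch_point (X : topologicalType) : set X :=
  [set x | (`I_3 #<= components_at x)%card].

(* An element n of {0, 1, 2, ...} \cup {oo} is encoded in option nat, with None
   for oo; color n is the set [n] of the natural numbers less than n. *)
Definition is_color (n : option nat) (m : nat) : bool :=
  if n is Some k then (m < k)%N else true.

Definition color (n : option nat) := {m : nat | is_color n m}.

Definition at_least_3 (n : option nat) : bool :=
  if n is Some k then (3 <= k)%N else true.

Definition wazewski (R : realType) (n : option nat) (X : topologicalType) :=
  [/\ dendrite R X,
      exists x y : X, x <> y,
      forall x : X, branch_point x ->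
        (components_at x #= [set: color n])%card &
      forall x y : X, x <> y -> open_arc R x y `&` @branch_point X !=set0].

(* Only the values c x C with x a branch point and C in components_at x are
   meaningful. *)
Record coloring (n : option nat) (X : topologicalType) := Coloring {
  col :> X -> set X -> color n;
  col_bij : forall x : X, branch_point x ->
    set_bij (components_at x) [set: color n] (col x) }.

Definition kaleidoscopic (R : realType) (n : option nat) (X : topologicalType)
    (c : coloring n X) :=
  forall x y : X, branch_point x -> branch_point y -> x <> y ->
  forall i j : color n, i <> j ->
  exists z : X, [/\ open_arc R x y z, branch_point z,
    c z (component_at z x) = i & c z (component_at z y) = j].
Arguments kaleidoscopic R {n X} c.

Section Homeo.
Context (X : topologicalType).

Definition homeo_set : set (sym X) :=
  [set g : sym X | continuous g /\ continuous (sym_inv g)].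

Lemma homeo_closed : group_closed (fun g : sym X => g \in homeo_set).
Proof.
split; first by rewrite unfold_in inE; split=> x; exact: cvg_id.
move=> f g; rewrite !unfold_in => /set_mem[/= cf cf'] /set_mem[/= cg cg'].
apply/mem_set; split=> x /=.
  by apply: continuous_comp; [exact: cg'|exact: cf].
by apply: continuous_comp; [exact: cf'|exact: cg].
Qed.

Definition homeo : subgroup (sym X) := Subgroup homeo_closed.

End Homeo.

Section Kaleidoscopic.
Context (n : option nat) (X : topologicalType) (c : coloring n X).
Implicit Types (g h : sym X) (x y : X).

(* sigma_c(g, x) as a self-map of [n], for x a branch point *)
Definition local_action g x : color n -> color n :=
  fun i => c (g x) (g @` ('pinv_(fun=> set0) (components_at x) (c x) i)).

Lemma image_connected_component (f : sym X) (A : set X) y :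
  continuous f -> f @` connected_component A y `<=`
                  connected_component (f @` A) (f y).
Proof.
move=> cf _ [z [C [Cy CA cC] Cz] <-]; exists (f @` C); last by exists z.
split; [by exists y|exact: image_subset|].
by apply: connected_continuous_connected => //; exact: continuous_subspaceT.
Qed.

Lemma image_compl1 (f : sym X) x : f @` (~` [set x]) = ~` [set f x].
Proof.
apply/seteqP; split=> [_ [z zx <-] fzx|z zfx].
  by apply: zx; move/(congr1 (sym_inv f)): fzx; rewrite !sym_funK.
by exists (sym_inv f z); [move=> e; apply: zfx; rewrite -e sym_invK|rewrite sym_invK].
Qed.

Lemma image_component_at (f : sym X) x y : homeo_set f ->
  f @` component_at x y = component_at (f x) (f y).
Proof.
move=> [cf cf']; apply/seteqP; split.
  by rewrite /component_at -image_compl1; exact: image_connected_component.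
move=> z fz; exists (sym_inv f z); last by rewrite sym_invK.
have := @image_connected_component (f^-1)%g (~` [set f x]) (f y) cf'.
rewrite image_compl1 /= !sym_funK => /(_ (sym_inv f z)); apply.
by exists z.
Qed.

Lemma image_components_at (f : sym X) x : homeo_set f ->
  components_at (f x) = (fun C => f @` C) @` components_at x.
Proof.
move=> hf; rewrite /components_at -image_compl1.
apply/seteqP; split=> [_ [_ [y yx <-] <-]|_ [_ [y yx <-] <-]].
  exists (component_at x y); first by exists y.
  exact: image_component_at.
by exists (f y); [exists y|rewrite image_component_at].
Qed.

Lemma sym_imageK g : cancel (fun C : set X => g @` C)
  (fun C => sym_inv g @` C).
Proof.
move=> C; rewrite image_comp -[RHS]image_id; apply: eq_imagel => z _ /=.
exact: sym_funK.
Qed.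

Lemma branch_point_homeo g x : homeo_set g ->
  branch_point (g x) <-> branch_point x.
Proof.
move=> hg; rewrite /branch_point /= image_components_at //.
by rewrite (card_le_eqr (inj_card_eq _)) // => C D _ _; exact: (can_inj (@sym_imageK g)).
Qed.

Lemma local_actionP g x (s : color n -> color n) :
  homeo_set g -> branch_point x ->
  local_action g x = s <->
  (forall C, components_at x C -> c (g x) (g @` C) = s (c x C)).
Proof.
move=> hg bx; have [_ cinj csurj] := col_bij c bx; split=> [<- C xC|cs].
  by rewrite /local_action pinvKV //; exact: mem_set.
apply/funext => i; rewrite /local_action.
have [C xC <-] := csurj i I.
by rewrite pinvKV // ?cs //; exact: mem_set.
Qed.

Definition kaleidoscopic_set (Gamma : subgroup (sym (color n))) :
    set (homeo X) :=
  [set g | forall x : X, branch_point x ->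
    exists2 s : sym (color n), subgroup_set Gamma s
      & local_action (val g) x = s].

Lemma kaleidoscopic_closed (Gamma : subgroup (sym (color n))) :
  group_closed (fun g : homeo X => g \in kaleidoscopic_set Gamma).
Proof.
have [G1 GD] := subgroup_closed Gamma.
have {}G1 : subgroup_set Gamma 1%g by apply/set_mem.
have {}GD s t : subgroup_set Gamma s -> subgroup_set Gamma t ->
    subgroup_set Gamma (s / t)%g.
  by move=> /mem_set Gs /mem_set Gt; apply/set_mem; exact: GD.
split; rewrite ?unfold_in.
  apply/mem_set => x bx; exists 1%g => //.
  apply/local_actionP => //; first exact: set_mem (valP (1%g : homeo X)).
  by move=> C _ /=; rewrite image_id.
move=> f g; rewrite !unfold_in => /set_mem Kf /set_mem Kg.
apply/mem_set => x bx.
have hf := set_mem (valP f); have hg := set_mem (valP g).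
pose y := sym_inv (val g) x.
have gy : val g y = x by rewrite /y sym_invK.
have yb : branch_point y by apply/(branch_point_homeo y hg); rewrite gy.
have [s Gs /(local_actionP _ hf yb) fs] := Kf y yb.
have [t Gt /(local_actionP _ hg yb) gt] := Kg y yb.
exists (s / t)%g; first exact: GD.
apply/local_actionP => //; first exact: set_mem (valP (f / g)%g).
move=> C; rewrite -{1}gy image_components_at // => -[D yD <-] /=.
rewrite -gy gt // gy [in RHS]/= sym_funK.
rewrite -fs // -/y; congr (c _ _).
by rewrite image_comp -[in RHS](sym_imageK (val g) D) !image_comp.
Qed.

Definition kaleidoscopic_group (Gamma : subgroup (sym (color n))) :
  subgroup (homeo X) := Subgroup (kaleidoscopic_closed Gamma).


End Kaleidoscopic.

Section Actions.
Context {G T : Type} (act : G -> T -> T).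

Definition action_orbit (x : T) : set T := [set act g x | g in [set: G]].

Definition generously_transitive_on (S : set T) :=
  forall x y, S x -> S y -> exists g, act g x = y /\ act g y = x.

Definition generously_transitive := generously_transitive_on [set: T].

(* The diagonal action on S1 x S2 is transitive. *)
Definition orthogonal_on (S1 S2 : set T) :=
  forall x1 x2 y1 y2, S1 x1 -> S2 x2 -> S1 y1 -> S2 y2 ->
    exists g, act g x1 = y1 /\ act g x2 = y2.

Definition semi_generous :=
  exists O1 O2 : set T,
    [/\ range action_orbit = [set O1; O2], O1 <> O2, orthogonal_on O1 O2,
        generously_transitive_on O1 & generously_transitive_on O2].

End Actions.

Definition perm_action (T : Type) (H : subgroup (sym T)) : H -> T -> T :=
  fun s => sym_fun (val s).

(* The functions from G^k to A are encoded as functions ('I_k -> G) -> A; those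
   of degree q are the functions on G^(q + 1). *)
Section Cohomology.
Context {G : groupType} {A : numDomainType}.

Definition invariant k (alpha : ('I_k -> G) -> A) :=
  forall (g : G) (x : 'I_k -> G), alpha (fun i => g * x i)%g = alpha x.

Definition bounded_cochain k (alpha : ('I_k -> G) -> A) :=
  exists M : A, forall x, `|alpha x| <= M.

Definition differential k (alpha : ('I_k -> G) -> A) : ('I_k.+1 -> G) -> A :=
  fun x => \sum_(j < k.+1) (-1) ^+ j * alpha (fun i => x (lift j i)).

Definition cocycles q : set (('I_q.+1 -> G) -> A) :=
  [set alpha | invariant alpha /\ differential alpha = fun=> 0].

Definition coboundaries q : set (('I_q.+1 -> G) -> A) :=
  [set differential beta | beta in @invariant q].

Definition bounded_cocycles q : set (('I_q.+1 -> G) -> A) :=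
  @cocycles q `&` @bounded_cochain q.+1.

Definition bounded_coboundaries q : set (('I_q.+1 -> G) -> A) :=
  [set differential beta | beta in @invariant q `&` @bounded_cochain q].

Definition nontrivial_class q (alpha : ('I_q.+1 -> G) -> A) :=
  cocycles alpha /\ ~ coboundaries alpha.

Definition nontrivial_bounded_class q (alpha : ('I_q.+1 -> G) -> A) :=
  bounded_cocycles alpha /\ ~ bounded_coboundaries alpha.

End Cohomology.

Definition real_cochain (R : realType) (G : groupType) k
    (alpha : ('I_k -> G) -> int) : ('I_k -> G) -> R :=
  fun x => (alpha x)%:~R.

(* Main.v *)
Require Import Defs.
From mathcomp Require Import all_boot all_order all_algebra.
From mathcomp Require Import all_classical all_reals all_analysis.
From mathcomp Require Import zify lra ring.

(* Three points that are not branch points have at most one branch point [z]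
   at which their colors [i, j, k] are pairwise distinct. For an alternating
   [Gamma]-invariant function [h] on pairs of colors, setting
   [omega p q r = h i j + h j k + h k i] defines an invariant cocycle, hence a
   cocycle [omega p (g p) (g' p)] on the group. If [Gamma] is neither
   generously transitive nor semi-generous, then for some [h] with values in
   [{-1, 0, 1}] this is not identically zero.

   Suppose that it is the coboundary of an invariant cochain, given by a
   function [b] on the group. A swindle computes [b] on the color-preserving
   [v] supported in a single component of the complement of a branch point:
   [b v = omega q p (v p)] for every fixed point [q] of [v] outside the closure
   of this component. Let [q1] and [q2] lie beyond the two ends of an arc, and
   let [p] hang off this arc at a branch point with colors [i, j, k]. There are
   such [v], [r], [u = v * r] fixing respectively [q1], [p], [q2] and such that
   [v p] hangs off the same arc at a branch point with colors [j, i, k]. Then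
   [b u = b v + b r] gives [omega q1 q2 p = omega q1 q2 (v p)], which is absurd
   when [h i j + h j k + h k i] is not zero.

   The homeomorphisms needed come from back-and-forth on the countable set of
   branch points: the arcs given by the definition of the Wazewski dendrite
   together with the kaleidoscopic property show that any two points are
   separated by a branch point, so that the components of the complements of
   the branch points generate the topology. *)

Set Implicit Arguments.
Unset Strict Implicit.
Unset Printing Implicit Defensive.

Import Order.TTheory GRing.Theory Num.Theory.
Import numFieldNormedType.Exports.

(** * Homogeneity of countable colored trees *)

Section ColoredTree.
Context {B : eqType} {C : Type} (kap : B -> B -> C).

(** Here [kap z x] stands for the color at [z] of the side containing [x], with no meaning for
    [x = z]; a center is the median of the triple. *)
Definition is_center m x y w :=
  [/\ m <> x, m <> y & m <> w] /\
  [/\ kap m x <> kap m y, kap m x <> kap m w & kap m y <> kap m w].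

(** What back-and-forth needs of the branch points. The equations in [ct_center] say that none of
    the three points is between the two others. *)
Record colored_tree : Prop := ColoredTree {
  ct_tree : forall z z' x, z <> z' -> x <> z -> x <> z' ->
    kap z x = kap z z' \/ kap z' x = kap z' z;
  ct_dense : forall x y i j, x <> y -> i <> j ->
    exists z, [/\ z <> x, z <> y, kap z x = i & kap z y = j];
  ct_full : forall z i, exists2 x, x <> z & kap z x = i;
  ct_center : forall x y w, x <> y -> x <> w -> y <> w ->
    kap x y = kap x w -> kap y x = kap y w -> kap w x = kap w y ->
    exists m, is_center m x y w;
  ct_other : forall i : C, exists j, j <> i }.

Hypothesis ct : colored_tree.

Lemma center_perm m x y w :
  is_center m x y w -> is_center m y x w /\ is_center m w x y.
Proof. by case=> [[? ? ?] [? ? ?]]; do !split=> //; exact: nesym. Qed.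

Definition center_closed (A : seq B) := forall m x y w,
  x \in A -> y \in A -> w \in A -> is_center m x y w -> m \in A.

Lemma center_closed_cons A w : center_closed A ->
  (forall m a d, a \in A -> d \in A -> is_center m w a d -> m \in w :: A) ->
  center_closed (w :: A).
Proof.
move=> Ac wA m x y z.
rewrite !(in_cons w A x) !(in_cons w A y) !(in_cons w A z).
case/predU1P=> [->|xA]; case/predU1P=> [->|yA]; case/predU1P=> [->|zA];
  move=> cm; try by case: cm => _ [].
- exact: wA cm.
- by case: (center_perm cm) => cm' _; exact: wA cm'.
- by case: (center_perm cm) => _ cm'; exact: wA cm'.
- by rewrite in_cons (Ac m x y z) ?orbT.
Qed.

Lemma exists_maximal (r : B -> B -> Prop) (P : B -> Prop) (A : seq B) x :
  (forall x, ~ r x x) ->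
  (forall x y z, P x -> P y -> P z -> r x y -> r y z -> r x z) ->
  x \in A -> P x -> exists2 y, y \in A /\ P y & forall a, a \in A -> P a -> ~ r y a.
Proof.
move=> irr tr; elim: A x => // a A IH x.
have [/hasP[/= x' x'A /asboolP Px'] _ _|/hasPn nP] := boolP (has (fun a => `[< P a >]) A).
  have [y [yA Py] ymax] := IH _ x'A Px'.
  have [[Pa ya]|nya] := EM (P a /\ r y a).
    exists a; first by rewrite mem_head.
    move=> b; rewrite in_cons => /predU1P[->|bA] Pb; first exact: irr.
    by move=> ab; apply: (ymax b) => //; exact: tr ya ab.
  exists y; first by rewrite in_cons yA orbT.
  move=> b; rewrite in_cons => /predU1P[->|bA] Pb; last exact: ymax.
  by move=> yb; apply: nya.
rewrite in_cons => /predU1P[->|xA] Px; last by have /asboolPn := nP _ xA.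
exists a; first by rewrite mem_head.
move=> b; rewrite in_cons => /predU1P[->|bA] Pb; first exact: irr.
by have /asboolPn := nP _ bA.
Qed.

(** The point [m] is on the open arc from [x] to [w]; as a relation from [x] to [m] this moves
    towards [w], so maximal elements are those closest to [w]. *)
Definition between w x m := [/\ m <> x, m <> w & kap m x <> kap m w].

Lemma between_trans w x m n : x <> w ->
  between w x m -> between w m n -> between w x n.
Proof.
move=> xw [mx mw cm] [nm nw cn].
have nx : n <> x.
  move=> nx; subst n; apply: cm.
  by case: (@ct_tree ct x m w) => //; congruence.
split=> //.
case: (@ct_tree ct n m x) => //; try congruence.
case: (@ct_tree ct n m w) => //; congruence.
Qed.

Lemma gate A w x y : center_closed A -> w \notin A ->
  x \in A -> y \in A -> kap w y <> kap w x ->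
  exists x0, [/\ x0 \in A, kap w x0 = kap w x &
    forall a, a \in A -> a <> x0 -> kap w a = kap w x -> kap x0 a <> kap x0 w].
Proof.
move=> Ac wA xA yA wyx.
have Aw a : a \in A -> a <> w by move=> + aw; rewrite aw (negPf wA).
have [||x0 [x0A cx0] x0max] := @exists_maximal (between w)
  (fun a => a \in A /\ kap w a = kap w x) A x _ _ xA (conj xA erefl).
- by move=> z [].
- by move=> a b d [/Aw aw _] _ _; exact: between_trans.
exists x0; split=> //; first by case: cx0.
move=> a aA ax0 cwa cx0a; case: cx0 => _ cx0.
have cax : kap a x0 = kap a w.
  apply: contrapT => h; apply: (x0max a) => //; split=> //; exact: Aw.
have [||||||m [[mx0 ma mw] [h1 h2 h3]]] := @ct_center ct x0 a w; try congruence.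
- exact: Aw.
- exact: Aw.
have wx : kap w x = kap w m.
  by case: (@ct_tree ct w m x0) => //; try congruence; exact: Aw.
have my : m <> y by congruence.
have cmy : kap m y = kap m w.
  by case: (@ct_tree ct w m y) => //; try congruence; exact: Aw.
have mA : m \in A by apply: (Ac m x0 a y) => //; do !split=> //; congruence.
by apply: (x0max m) => //; split=> //; congruence.
Qed.

(** A third side of [w] meeting [A] would make [w] a median of points of [A]. A median of [w], [a],
    [d] is also that of [z], [a], [d] for some [z] in [A] on another side of [w]. *)
Lemma center_closed_between A w x y : center_closed A -> w \notin A ->
  x \in A -> y \in A -> kap w x <> kap w y ->
  (forall a, a \in A -> kap w a = kap w x \/ kap w a = kap w y) /\
  center_closed (w :: A).
Proof.
move=> Ac wA xA yA wxy.
have Aw a : a \in A -> a <> w by move=> + aw; rewrite aw (negPf wA).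
have two a : a \in A -> kap w a = kap w x \/ kap w a = kap w y.
  move=> aA; apply: contrapT => /not_orP[h1 h2].
  have [aw xw yw] : [/\ a <> w, x <> w & y <> w] by split; exact: Aw.
  by move/negP: wA; apply; apply: (Ac w a x y) => //; do !split=> //; congruence.
split=> //; apply: center_closed_cons => // m a d aA dA.
case=> [[mw ma md] [h1 h2 h3]].
have [wa wd ww wy] : [/\ a <> w, d <> w, x <> w & y <> w] by split; exact: Aw.
have cwa : kap w a = kap w m by case: (@ct_tree ct w m a) => //; congruence.
have cwd : kap w d = kap w m by case: (@ct_tree ct w m d) => //; congruence.
have [z zA cz] : exists2 z, z \in A & kap w z <> kap w a.
  by case: (two _ aA) => ->; [exists y => //; congruence|exists x].
have zw := Aw _ zA.
have mz : m <> z by congruence.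
have cmz : kap m z = kap m w by case: (@ct_tree ct w m z) => //; congruence.
by rewrite in_cons (Ac m z a d) ?orbT //; do !split=> //; congruence.
Qed.

(** Here [w] hangs off [A] at [m]. A median [n] of [w], [a], [d] other than [m] is also that of [m],
    [a], [d], unless it is between [w] and [m]; but then all of [A] is on one side of [n]. *)
Lemma center_closed_leaf A w m : center_closed A -> m \in A -> w <> m ->
  (forall a, a \in A -> a <> m -> kap m a <> kap m w) ->
  center_closed (w :: A).
Proof.
move=> Ac mA wm mw; apply: center_closed_cons => // n a d aA dA.
case=> [[nw na nd] [h1 h2 h3]]; rewrite in_cons.
have [nm|/eqP nm] := eqVneq n m; first by rewrite nm mA orbT.
have [nwm|nwm] := EM (kap n w = kap n m).
  by rewrite (Ac n m a d) ?orbT //; do !split=> //; congruence.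
have cmw : kap m w = kap m n by case: (@ct_tree ct n m w) => //; congruence.
have K b : b \in A -> n <> b -> kap n b = kap n m.
  move=> bA nb; have [->//|/eqP bm] := eqVneq b m.
  have := mw _ bA bm.
  by case: (@ct_tree ct n m b) => //; congruence.
by have := K _ aA na; have := K _ dA nd; congruence.
Qed.

(** * Finite partial isomorphisms *)

Definition partial_iso (s : seq (B * B)) :=
  [/\ center_closed (unzip1 s), center_closed (unzip2 s) &
      forall p q, p \in s -> q \in s -> (p.1 = q.1 <-> p.2 = q.2) /\
        (p.1 <> q.1 -> kap p.1 q.1 = kap p.2 q.2)].

Lemma partial_iso_flip s :
  partial_iso s -> partial_iso [seq (p.2, p.1) | p <- s].
Proof.
move=> [c1 c2 h]; split.
- by rewrite /unzip1 -map_comp.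
- by rewrite /unzip2 -map_comp.
- move=> _ _ /mapP[p ps ->] /mapP[q qs ->] /=.
  by have [[h1 h2] h3] := h _ _ ps qs; split=> // pq; rewrite h3 // => /h1.
Qed.

Lemma partial_iso_cons s w w' : partial_iso s ->
  center_closed (w :: unzip1 s) -> center_closed (w' :: unzip2 s) ->
  (forall p, p \in s -> [/\ w <> p.1, w' <> p.2, kap w p.1 = kap w' p.2 &
                           kap p.1 w = kap p.2 w']) ->
  partial_iso ((w, w') :: s).
Proof.
move=> [c1 c2 h] cw cw' hw; split=> // p q.
rewrite !in_cons => /predU1P[->|ps] /predU1P[->|qs] //=; last exact: h.
- by have [] := hw _ qs; split.
- by have [] := hw _ ps; split=> //; split=> /esym.
Qed.

(** The image of [w] is chosen by density between the images of the two gates, the points of the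
    domain closest to [w] on its two sides, with the colors that [w] has towards them. *)
Lemma partial_iso_between s w x y : partial_iso s ->
  w \notin unzip1 s -> x \in unzip1 s -> y \in unzip1 s ->
  kap w x <> kap w y -> exists w', partial_iso ((w, w') :: s).
Proof.
move=> hs ws xs ys wxy; have [c1 c2 h] := hs.
have [two cw] := center_closed_between c1 ws xs ys wxy.
have [x0 [x0s wx0 gx]] := gate c1 ws xs ys (nesym wxy).
have [y0 [y0s wy0 gy]] := gate c1 ws ys xs wxy.
have Aw a : a \in unzip1 s -> a <> w by move=> + aw; rewrite aw (negPf ws).
have [[p px x0p]] := (mapP x0s, mapP y0s).
move=> /cid2[q qs y0q]; move: px x0p => ps x0p; subst x0 y0.
have pq : p.2 <> q.2.
  by have [[_ pq] _] := h _ _ ps qs; move=> /pq e; rewrite e in wx0; congruence.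
have [w' [w'p w'q wp wq]] := ct_dense ct pq wxy.
exists w'.
(* Any [r] behind the gate [u] sees [w] as it sees [u], and [w] sees [r] as it sees [u]; the same
   holds for the images. *)
have side (u v r : B * B) : u \in s -> v \in s -> r \in s ->
    kap w u.1 <> kap w v.1 -> kap w r.1 = kap w u.1 ->
    w' <> u.2 -> w' <> v.2 -> kap w' u.2 = kap w u.1 -> kap w' v.2 = kap w v.1 ->
    (forall a, a \in unzip1 s -> a <> u.1 -> kap w a = kap w u.1 ->
       kap u.1 a <> kap u.1 w) ->
    [/\ w <> r.1, w' <> r.2, kap w r.1 = kap w' r.2 & kap r.1 w = kap r.2 w'].
  move=> us vs rs wuv wru w'u w'v w'cu w'cv gu.
  have uw : u.1 <> w by apply: Aw; exact: map_f.
  have vw : v.1 <> w by apply: Aw; exact: map_f.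
  have rw : r.1 <> w by apply: Aw; exact: map_f.
  have [[uv1 uv2] uvc] := h _ _ us vs.
  have uv : u.1 <> v.1 by congruence.
  have {}uvc := uvc uv.
  have cu : kap u.1 w = kap u.1 v.1 by case: (@ct_tree ct u.1 w v.1) => //; congruence.
  have uv' : u.2 <> v.2 by move=> /uv2.
  have cu' : kap u.2 w' = kap u.2 v.2 by case: (@ct_tree ct u.2 w' v.2) => //; congruence.
  have [ru|ru] := EM (r.1 = u.1).
    have [[ru' _] _] := h _ _ rs us; have {}ru' := ru' ru.
    by split; congruence.
  have [[ru1 ru2] ruc] := h _ _ rs us; have {}ruc := ruc ru.
  have [_ urc] := h _ _ us rs; have {}urc := urc (nesym ru).
  have := gu _ (map_f _ rs) ru wru => gru.
  have ru' : r.2 <> u.2 by move=> /ru2.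
  have wr' : w' <> r.2 by congruence.
  have e1 : kap r.1 w = kap r.1 u.1 by case: (@ct_tree ct r.1 u.1 w) => //; congruence.
  have e2 : kap r.2 w' = kap r.2 u.2 by case: (@ct_tree ct r.2 u.2 w') => //; congruence.
  have e3 : kap w' r.2 = kap w' u.2 by case: (@ct_tree ct w' u.2 r.2) => //; congruence.
  by split; congruence.
have hw r : r \in s ->
    [/\ w <> r.1, w' <> r.2, kap w r.1 = kap w' r.2 & kap r.1 w = kap r.2 w'].
  move=> rs; case: (two _ (map_f _ rs)) => wr.
    apply: (side p q r); rewrite ?wx0 ?wy0 //.
  apply: (side q p r); rewrite ?wx0 ?wy0 //; exact: nesym.
apply: partial_iso_cons => //.
have w's : w' \notin unzip2 s.
  by apply/negP => /mapP[r rs w'r]; have [_ /(_ w'r)] := hw _ rs.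
have [] := @center_closed_between _ w' p.2 q.2 c2 w's (map_f _ ps) (map_f _ qs) => //.
by congruence.
Qed.

(** The image of [w] is taken between the image of [m] and some [x] on the side of it that has the
    color of [w]; its color towards the image of [m] is [kap w m], and that towards [x] is any
    other. *)
Lemma partial_iso_leaf s w m : partial_iso s ->
  w \notin unzip1 s -> m \in unzip1 s ->
  (forall a, a \in unzip1 s -> a <> m -> kap m a <> kap m w) ->
  exists w', partial_iso ((w, w') :: s).
Proof.
move=> hs ws ms mw; have [c1 c2 h] := hs.
have Aw a : a \in unzip1 s -> a <> w by move=> + aw; rewrite aw (negPf ws).
case/mapP: (ms) => p ps mp; subst m.
have [x xp cx] := ct_full ct p.2 (kap p.1 w).
have [j jw] := ct_other ct (kap w p.1).
have [w' [w'p w'x cw'p cw'x]] := ct_dense ct (nesym xp) (nesym jw).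
have cpw' : kap p.2 w' = kap p.1 w.
  by case: (@ct_tree ct p.2 w' x) => //; congruence.
exists w'.
have pw := Aw _ ms.
have hw r : r \in s ->
    [/\ w <> r.1, w' <> r.2, kap w r.1 = kap w' r.2 & kap r.1 w = kap r.2 w'].
  move=> rs; have [[h1 h2] h3] := h _ _ rs ps; have rw := Aw _ (map_f _ rs).
  have [rp|rp] := EM (r.1 = p.1); first by have := h1 rp; split; congruence.
  have [_ h4] := h _ _ ps rs.
  have {}h3 := h3 rp; have {}h4 := h4 (nesym rp).
  have rp' : r.2 <> p.2 by move=> /h2.
  have gr := mw _ (map_f _ rs) rp.
  have w'r : w' <> r.2 by congruence.
  have e1 : kap r.1 w = kap r.1 p.1 by case: (@ct_tree ct r.1 p.1 w) => //; congruence.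
  have e2 : kap r.2 w' = kap r.2 p.2 by case: (@ct_tree ct r.2 p.2 w') => //; congruence.
  have e3 : kap w' r.2 = kap w' p.2 by case: (@ct_tree ct w' p.2 r.2) => //; congruence.
  have e4 : kap w r.1 = kap w p.1 by case: (@ct_tree ct w p.1 r.1) => //; congruence.
  by split; congruence.
apply: partial_iso_cons => //.
  by apply: (@center_closed_leaf _ w p.1) => //; exact: nesym.
apply: (@center_closed_leaf _ w' p.2) => //; first exact: map_f.
move=> _ /mapP[r rs ->] rp.
have [[h1 h2] _] := h _ _ rs ps; have [_ h4] := h _ _ ps rs.
have rp1 : r.1 <> p.1 by move=> /h1.
by rewrite -h4 ?cpw'; [apply: mw => //; exact: map_f|exact: nesym].
Qed.

(** If [w] does not separate the domain, let [x] be a point of the domain closest to [w]. Either [w]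
    hangs off the domain at [x], or it does so at the median [m] of [x], [w] and some [a], which
    separates [x] from [a] and is added first. *)
Lemma partial_iso_forth s w : s != [::] -> partial_iso s ->
  exists s', [/\ partial_iso s', {subset s <= s'} & w \in unzip1 s'].
Proof.
move=> s0 hs; have [c1 c2 h] := hs.
have [ws|ws] := boolP (w \in unzip1 s); first by exists s; split.
have Aw a : a \in unzip1 s -> a <> w by move=> + aw; rewrite aw (negPf ws).
have add t w' : {subset s <= t} -> partial_iso ((w, w') :: t) ->
    exists s', [/\ partial_iso s', {subset s <= s'} & w \in unzip1 s'].
  move=> st ht; exists ((w, w') :: t); split=> //; last exact: mem_head.
  by move=> p /st pt; rewrite in_cons pt orbT.
have [[x [y [xs ys wxy]]]|same] := EM (exists x y,
    [/\ x \in unzip1 s, y \in unzip1 s & kap w x <> kap w y]).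
  by have [w' /add] := partial_iso_between hs ws xs ys wxy; apply.
have {}same x y : x \in unzip1 s -> y \in unzip1 s -> kap w x = kap w y.
  by move=> xs ys; apply: contrapT => wxy; apply: same; exists x, y.
have [x0 x0s] : exists x, x \in unzip1 s.
  by case: (s) s0 => // p s' _; exists p.1; exact: mem_head.
have [||x [xs _] xmax] := @exists_maximal (between w)
  (fun a => a \in unzip1 s) _ _ _ _ x0s x0s.
- by move=> z [].
- by move=> a b d /Aw aw _ _; exact: between_trans.
have [[a [as_ ax cxa]]|leaf] := EM (exists a,
    [/\ a \in unzip1 s, a <> x & kap x a = kap x w]); last first.
  have [|w' /add] := partial_iso_leaf hs ws xs; last by apply.
  by move=> a as_ ax cxa; apply: leaf; exists a.
have [aw xw] : a <> w /\ x <> w by split; exact: Aw.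
have cax : kap a x = kap a w.
  by apply: contrapT => h'; apply: (xmax a) => //; split=> //; congruence.
have cwa := same _ _ as_ xs.
have [||||||m [[mx ma mw] [h1 h2 h3]]] := @ct_center ct x a w; try congruence.
have ms : m \notin unzip1 s by apply/negP => ms; apply: (xmax m) => //; split.
have [m' hm] := partial_iso_between hs ms xs as_ h1.
have [|||w' /add] := @partial_iso_leaf _ w m hm; last first.
- by apply=> p ps; rewrite in_cons ps orbT.
- move=> b; rewrite /= in_cons => /predU1P[->//|bs] bm cmb.
  move/negP: ms; apply; apply: (c1 m x a b) => //.
  by do !split=> //; congruence.
- exact: mem_head.
- by rewrite /= in_cons negb_or ws andbT; apply/eqP; exact: nesym.
Qed.

Lemma partial_iso_back_forth s w : s != [::] -> partial_iso s ->
  exists s', [/\ partial_iso s', {subset s <= s'}, w \in unzip1 s' & w \in unzip2 s'].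
Proof.
move=> s0 hs.
have [s1 [h1 ss1 ws1]] := partial_iso_forth w s0 hs.
have [||s2 [h2 ss2 ws2]] := @partial_iso_forth [seq (p.2, p.1) | p <- s1] w.
- by case: s1 ws1 {h1 ss1}.
- exact: partial_iso_flip.
exists [seq (p.2, p.1) | p <- s2]; split.
- exact: partial_iso_flip.
- move=> p ps; apply/mapP; exists (p.2, p.1); last by case: p {ps}.
  by apply: ss2; apply/mapP; exists p => //; exact: ss1.
- case/mapP: ws1 => p ps ->; apply/mapP; exists p => //.
  apply/mapP; exists (p.2, p.1); last by case: p {ps}.
  by apply: ss2; apply/mapP; exists p.
- by rewrite /unzip2 -map_comp.
Qed.

(** Back-and-forth along the enumeration [e], from a two-point partial isomorphism; the graph [Rel]
    of the automorphism is the union of the stages. *)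
Lemma colored_tree_homogeneous (e : nat -> B) y t y' t' :
  (forall x, exists k, e k = x) ->
  y <> t -> y' <> t' -> kap y t = kap y' t' -> kap t y = kap t' y' ->
  exists a a' : B -> B, [/\ cancel a a', cancel a' a,
    forall z x, x <> z -> kap (a z) (a x) = kap z x, a y = y' & a t = t'].
Proof.
move=> eS yt yt' cy ct'.
pose good (s : seq (B * B)) := partial_iso s /\ s != [::].
have good0 : good [:: (y, y'); (t, t')].
  have cc (u v : B) : center_closed [:: u; v].
    move=> m x1 x2 x3; rewrite !inE => /orP[]/eqP-> /orP[]/eqP-> /orP[]/eqP->;
    by case=> _ [].
  split=> //; split; [exact: cc|exact: cc|] => p q; rewrite !inE.
  by move=> /orP[]/eqP-> /orP[]/eqP-> /=; split=> //; split=> // /esym.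
have step (s : {s | good s}) k : {s' : {s | good s} |
    [/\ {subset sval s <= sval s'}, e k \in unzip1 (sval s') &
        e k \in unzip2 (sval s')]}.
  apply: cid; case: s => s [hs s0] /=.
  have [s' [hs' ss' k1 k2]] := partial_iso_back_forth (e k) s0 hs.
  have s'0 : s' != [::] by case: s' k1 {hs' ss' k2}.
  by exists (exist _ s' (conj hs' s'0)).
pose S := fix S k := if k is k'.+1 then sval (step (S k') k') else exist _ _ good0.
have SS k l : k <= l -> {subset sval (S k) <= sval (S l)}.
  elim: l => [|l IH]; first by rewrite leqn0 => /eqP->.
  rewrite leq_eqVlt => /predU1P[->//|]; rewrite ltnS => /IH kl p /kl.
  by have [ss' _ _] := svalP (step (S l) l); exact: ss'.
pose Rel x x' := exists k, (x, x') \in sval (S k).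
have Relc x x' z z' : Rel x x' -> Rel z z' ->
    (x = z <-> x' = z') /\ (x <> z -> kap x z = kap x' z').
  move=> [k xk] [l zl].
  have xm := SS _ _ (leq_maxl k l) _ xk; have zm := SS _ _ (leq_maxr k l) _ zl.
  by case: (S (maxn k l)) xm zm => s /= [[_ _ h] _] xs zs; exact: h xs zs.
have dom x : exists x', Rel x x'.
  have [k <-] := eS x.
  have : e k \in unzip1 (sval (S k.+1)) by have [] := svalP (step (S k) k).
  by case/mapP=> -[u v] uv ->; exists v, k.+1.
have ran x' : exists x, Rel x x'.
  have [k <-] := eS x'.
  have : e k \in unzip2 (sval (S k.+1)) by have [] := svalP (step (S k) k).
  by case/mapP=> -[u v] uv ->; exists u, k.+1.
have /choice[a Ra] := dom; have /choice[a' Ra'] := ran.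
have RE x x' : Rel x x' -> a x = x'.
  by move=> h; have [[h1 _] _] := Relc _ _ _ _ (Ra x) h; exact: h1.
have RE' x x' : Rel x x' -> a' x' = x.
  by move=> h; have [[_ h1] _] := Relc _ _ _ _ (Ra' x') h; exact: h1.
exists a, a'; split.
- by move=> x; exact: RE'.
- by move=> x; exact: RE.
- move=> z x xz; have [_ h] := Relc _ _ _ _ (Ra z) (Ra x).
  by rewrite h //; exact: nesym.
- by apply: RE; exists 0; rewrite /= !inE eqxx.
- by apply: RE; exists 0; rewrite /= !inE eqxx orbT.
Qed.

End ColoredTree.

Local Open Scope classical_set_scope.
Local Open Scope ring_scope.

(** * Sides of a point *)

Lemma compact_finite_intersection (X : topologicalType) (I : eqType)
    (D : set I) (F : I -> set X) :
  compact [set: X] -> (forall i, D i -> closed (F i)) ->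
  (forall s : seq I, (forall i, i \in s -> D i) ->
     exists x, forall i, i \in s -> F i x) ->
  exists x, forall i, D i -> F i x.
Proof.
move=> cX clF fin.
pose G : set_system X := [set A | exists2 s : seq I, (forall i, i \in s -> D i) &
  forall x, (forall i, i \in s -> F i x) -> A x].
have GF : ProperFilter G.
  split; first by case=> s sD sF; have [x /sF] := fin s sD.
  split; first by exists [::].
    move=> P Q [s sD sP] [t tD tQ]; exists (s ++ t).
      by move=> i; rewrite mem_cat => /orP[/sD|/tD].
    move=> x xst; split; [apply: sP|apply: tQ] => i ist; apply: xst;
      by rewrite mem_cat ist ?orbT.
  by move=> P Q PQ [s sD sP]; exists s => // x /sP /PQ.
have [x [_ xG]] := cX G GF (@filterT _ G _).
exists x => i Di; rewrite -[F i]/(F i); have := clF _ Di; rewrite closedE; apply.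
move=> xF; have Gi : G (F i).
  by exists [:: i] => [j|y]; [rewrite inE => /eqP->|apply; rewrite inE].
by have [y [Fy nFy]] := xG _ _ Gi xF.
Qed.

Section SameSide.
Context {X : topologicalType}.
Implicit Types m a b x y z : X.

(** The component of a point outside the given set is empty, so this implies that [a] and [b] differ
    from [m]. *)
Definition same_side m a b := component_at m a b.

Lemma same_side_neql m a b : same_side m a b -> a <> m.
Proof.
move=> + am; rewrite /same_side /component_at am connected_component_out //.
by move=> /=; exact.
Qed.

Lemma same_side_refl m a : a <> m -> same_side m a a.
Proof. by move=> am; exact: connected_component_refl. Qed.

Lemma same_side_sym m a b : same_side m a b -> same_side m b a.
Proof. exact: connected_component_sym. Qed.

Lemma same_side_trans m a b d :
  same_side m a b -> same_side m b d -> same_side m a d.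
Proof. exact: connected_component_trans. Qed.

Lemma same_side_neqr m a b : same_side m a b -> b <> m.
Proof. by move=> /same_side_sym/same_side_neql. Qed.

Lemma same_sideE m a b : a <> m -> same_side m a b <-> component_at m a = component_at m b.
Proof.
move=> am; split; first exact: same_connected_component.
by move=> e; apply: same_side_sym; rewrite /same_side -e; exact: same_side_refl.
Qed.

Lemma connected_same_side (S : set X) m a b :
  connected S -> ~ S m -> S a -> S b -> same_side m a b.
Proof.
move=> cS Sm Sa Sb; exists S => //; split=> // x Sx xm.
by apply: Sm; rewrite -xm.
Qed.

Hypothesis closed1 : forall x, closed [set x].
Hypothesis lcX : locally_connected X.
Hypothesis cX : connected [set: X].

Lemma open_same_side m a : open [set b | same_side m a b].
Proof.
rewrite openE => b ab.
have [V [oV Vb cV Vm]] := @lcX b (~` [set m]) (open_nbhs_nbhs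
  (conj (closed_openC (@closed1 m)) (same_side_neqr ab))).
apply: filterS (open_nbhs_nbhs (conj oV Vb)) => d Vd.
apply: same_side_trans ab _; apply: connected_same_side Vb Vd => //.
by move=> /Vm; exact.
Qed.

Lemma connected_clopen (S : set X) x y : open S -> closed S -> S x -> S y.
Proof.
move=> oS cS Sx; rewrite (cX (B := S)) //; first by exists x.
  by exists S => //; rewrite setTI.
by exists S => //; rewrite setTI.
Qed.

(* Boundary bumping: the closure of a component of [X \ {z}] contains [z]. *)
Lemma same_side_tree z z' x : z <> z' -> same_side z x z' \/ same_side z' x z.
Proof.
move=> zz'; have [xz|xz] := EM (x = z).
  by right; rewrite xz; exact: same_side_refl.
have [|nxz'] := EM (same_side z x z'); [by left|right].
have clx y : closure (same_side z x) y -> y <> z -> same_side z x y.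
  move=> cy yz; have [d [xd yd]] := cy _ (open_nbhs_nbhs
    (conj (open_same_side z y) (same_side_refl yz))).
  exact: same_side_trans xd (same_side_sym yd).
have cz : closure (same_side z x) z.
  apply: contrapT => ncz.
  have cl : closed (same_side z x).
    by move=> y cy; apply: clx => // yz; move: cy; rewrite yz.
  have := @connected_clopen _ x z (open_same_side z x) cl (same_side_refl xz).
  by move/same_side_neqr.
apply: connected_same_side (connected_closure _) _ _ cz.
- exact: component_connected.
- by move=> cz'; apply: nxz'; apply: clx => //; exact: nesym.
- by apply: subset_closure; exact: same_side_refl.
Qed.

End SameSide.

(** * Existence of medians *)

Lemma ord3_meet (i j k l : 'I_3) :
  i != j -> k != l -> [|| i == k, i == l, j == k | j == l].
Proof.
rewrite -!val_eqE /=.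
have := ltn_ord i; have := ltn_ord j; have := ltn_ord k; have := ltn_ord l.
by lia.
Qed.

Lemma ord3_others (k : 'I_3) : exists i j, [/\ i != j, i != k & j != k].
Proof.
by case: k => -[|[|[|//]]] h;
 [exists 1, 2|exists 0, 2|exists 0, 1].
Qed.

Lemma connected_sub_interior (X : topologicalType) (V O : set X) a :
  connected V -> open O -> (forall q, V q -> O q \/ (~` O)° q) ->
  V a -> O a -> V `<=` O.
Proof.
move=> cV oO VO Va Oa; apply/setIidPl; apply: cV; first by exists a.
  by exists O.
exists (~` (~` O)°); first by apply: open_closedC; exact: open_interior.
apply/seteqP; split=> q [Vq Oq]; split=> //.
  by move=> /interior_subset.
by case: (VO _ Vq).
Qed.

Section Median.
Context {X : topologicalType}.
Hypothesis closed1 : forall x : X, closed [set x].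
Hypothesis lcX : locally_connected X.
Hypothesis cX : connected [set: X].
Hypothesis sepX : forall x y : X, x <> y ->
  exists m, [/\ m <> x, m <> y & ~ same_side m x y].

Section Majority.
Context (v : 'I_3 -> X).
Hypothesis v_inj : injective v.
Hypothesis v_end : forall i j k, i != j -> i != k -> j != k ->
  same_side (v k) (v i) (v j).

(* Without a median, each [m] has a side containing two of the [v i]: its
   majority side. The points cut off together with [v i] from some majority
   side form a set that is clopen in [X], or in [X \ {p}] if [p] is on all
   majority sides. *)
Definition majority m q :=
  exists i j, [/\ i != j, same_side m (v i) q & same_side m (v j) q].

Definition minority i q := exists m, [/\ q <> m, ~ majority m q & ~ majority m (v i)].

Lemma majority_same_side m p q : majority m p -> majority m q -> same_side m p q.
Proof.
move=> [i [j [ij ip jp]]] [k [l [kl kq lq]]].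
have jn a b d : same_side m a b -> same_side m a d -> same_side m b d.
  by move=> ab ad; exact: same_side_trans (same_side_sym ab) ad.
by case/or4P: (ord3_meet ij kl) => /eqP e; subst;
  [exact: jn ip kq|exact: jn ip lq|exact: jn jp kq|exact: jn jp lq].
Qed.

Lemma majority_trans m p q : same_side m p q -> majority m p -> majority m q.
Proof.
move=> pq [i [j [ij ip jp]]]; exists i, j.
by split; [|exact: same_side_trans ip pq|exact: same_side_trans jp pq].
Qed.

Lemma majority_pair m i j : i != j -> same_side m (v i) (v j) -> majority m (v i).
Proof.
move=> ij h; exists i, j; split=> //; last exact: same_side_sym.
by apply: same_side_refl; exact: same_side_neql h.
Qed.

Lemma majorityP m i : majority m (v i) ->
  exists2 j, i != j & same_side m (v i) (v j).
Proof.
move=> [k [l [kl ki li]]]; have [ik|ik] := eqVneq i k; last first.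
  by exists k => //; exact: same_side_sym.
by exists l; [rewrite ik|exact: same_side_sym].
Qed.

Lemma minority_open i : open (minority i).
Proof.
rewrite openE => q [m [qm mq mi]].
have nq : nbhs q (same_side m q).
  apply: open_nbhs_nbhs; split; last exact: same_side_refl.
  exact: open_same_side.
apply: filterS nq => q' qq'; exists m; split=> //.
  exact: same_side_neqr qq'.
by move=> /(majority_trans (same_side_sym qq')).
Qed.

(** If [v i] is on the majority side of [m], then any [m'] that cuts [v i] off from its own majority
    side is on that side of [m]. All points off the majority side of [m], such as [q] and those near
    it, are then on one side of [m'], which cuts them off together or not at all. *)
Lemma minority_closed i q : (exists2 m, q <> m & ~ majority m q) ->
  minority i q \/ (~` minority i)° q.
Proof.
move=> [m qm mq]; have [|ni] := EM (minority i q); [by left|right].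
have mi : majority m (v i) by apply: contrapT => mi; apply: ni; exists m.
have nq : nbhs q (same_side m q).
  apply: open_nbhs_nbhs; split; last exact: same_side_refl.
  exact: open_same_side.
apply: filterS nq => q' qq' [m' [q'm' m'q' m'i]]; apply: ni.
have [e ie mie] := majorityP mi.
have m'ie : ~ same_side m' (v i) (v e) by move=> /(majority_pair ie).
have mm' : m <> m' by move=> e'; apply: m'ie; rewrite -e'.
have mim' : same_side m (v i) m'.
  apply: contrapT => h; apply: m'ie.
  apply: (@connected_same_side _ (same_side m (v i))) => //.
    exact: component_connected.
  by apply: same_side_refl; exact: same_side_neql mie.
have far r : ~ majority m r -> same_side m' r m.
  move=> mr; have [h|//] := @same_side_tree _ closed1 lcX cX m m' r mm'.
  exfalso; apply: mr; apply: majority_trans mi.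
  exact: same_side_trans mim' (same_side_sym h).
have mq' : ~ majority m q' by move=> /(majority_trans (same_side_sym qq')).
have h : same_side m' q q'.
  exact: same_side_trans (far _ mq) (same_side_sym (far _ mq')).
exists m'; split=> //; first exact: same_side_neql h.
by move=> /(majority_trans h).
Qed.

Lemma exists_median : exists m, (forall i, m <> v i) /\
  (forall i j, i != j -> ~ same_side m (v i) (v j)).
Proof.
apply: contrapT => nomed.
have tot m : exists i j, i != j /\ same_side m (v i) (v j).
  have [[k mk]|mk] := EM (exists k, m = v k).
    have [i [j [ij ik jk]]] := ord3_others k.
    by exists i, j; split=> //; rewrite mk; exact: v_end.
  apply: contrapT => h; apply: nomed; exists m; split.
    by move=> k mk'; apply: mk; exists k.
  by move=> i j ij hij; apply: h; exists i, j.
(* Two of the indices are on the majority side of [m], so [i] and [j] are not both off it. *)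
have min_neq i j : i != j -> ~ minority i (v j).
  move=> ij [m [_ mj mi]]; have [k [l [kl h]]] := tot m.
  have mk := majority_pair kl h.
  have ml : majority m (v l).
    by apply: (@majority_pair _ _ k); [rewrite eq_sym|exact: same_side_sym].
  by case/or4P: (ord3_meet kl ij) => /eqP e; subst.
(* If [p] is on all majority sides, the side of [p] containing some [v i] lies in [minority i],
   hence contains no other [v j], and [p] is a median or contradicts [v_end]. *)
have [[p pP]|noP] := EM (exists p, forall m, m <> p -> majority m p).
  have sep i : v i <> p -> minority i (v i).
    move=> ip; have [m [mi mp h]] := sepX ip.
    have mi' : ~ majority m (v i).
      move=> mi'; apply: h; exact: majority_same_side mi' (pP _ mp).
    by exists m; split=> //; exact: nesym.
  have nss i j : i != j -> v i <> p -> ~ same_side p (v i) (v j).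
    move=> ij ip h; apply: (min_neq i j) => //.
    apply: (@connected_sub_interior _ (same_side p (v i)) _ (v i)) h.
    - exact: component_connected.
    - exact: minority_open.
    - move=> q /same_side_neqr qp; apply: minority_closed.
      have [m [mq mp h]] := sepX qp.
      exists m; first exact: nesym.
      by move=> mq'; apply: h; apply: majority_same_side mq' (pP _ mp).
    - exact: same_side_refl.
    - exact: sep.
  have [[k pk]|np] := EM (exists k, p = v k).
    have [i [j [ij ik jk]]] := ord3_others k.
    apply: (nss _ _ ij); last by rewrite pk; exact: v_end.
    by rewrite pk => /v_inj ik'; rewrite ik' eqxx in ik.
  apply: nomed; exists p; split=> [k pk|i j ij]; first by apply: np; exists k.
  by apply: nss => // ip; apply: np; exists i.
(* Otherwise each [minority i] is clopen in [X], so it misses [v i], as it would else contain all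
   [v j]; but a separator of [v 0] and [v 1] puts one of them in its own minority. *)
have W q : exists2 m, q <> m & ~ majority m q.
  apply: contrapT => h; apply: noP; exists q => m mq.
  by apply: contrapT => mq'; apply: h; exists m => //; exact: nesym.
have all i : ~ minority i (v i).
  move=> ii; have [j [_ [_ ij _]]] := ord3_others i.
  apply: (min_neq i j); first by rewrite eq_sym.
  apply: (@connected_sub_interior _ setT _ (v i)) => //.
    exact: minority_open.
  by move=> q _; exact: minority_closed.
have [|m [mx my h]] := sepX (x := v 0) (y := v 1); first by move=> /v_inj.
have [m0|m0] := EM (majority m (v 0)); last first.
  by apply: (all 0); exists m; split=> //; exact: nesym.
apply: (all 1); exists m; split=> //; first exact: nesym.
  by move=> m1; apply: h; exact: majority_same_side.
by move=> m1; apply: h; exact: majority_same_side.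
Qed.
End Majority.

End Median.

(** * Kaleidoscopic dendrites *)

Lemma metrizable_closed1 (R : realType) (X : topologicalType) :
  metrizable R X -> forall x : X, closed [set x].
Proof.
move=> [d [d0 dE dC _ dn]] x; rewrite -openC openE => y /= yx.
apply/dn; exists (d y x).
  by rewrite lt_neqAle d0 andbT; apply/eqP => /esym/dE.
by move=> z /= + zx; rewrite zx ltxx.
Qed.

Lemma color_other2 (n : option nat) (i j : color n) :
  at_least_3 n -> exists k, k <> i /\ k <> j.
Proof.
move=> n3; have c3 m : (m < 3)%N -> is_color n m.
  by case: n n3 {i j} => //= n n3 m3; exact: leq_trans n3.
pose K m (h : (m < 3)%N) : color n := exist _ m (c3 m h).
have nK k m h : val k <> m -> @K m h <> k by move=> km e; apply: km; rewrite -e.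
have [[h0 h1]|] := EM (val i <> 0%N /\ val j <> 0%N).
  by exists (@K 0%N isT); split; exact: nK.
have [[h0 h1]|] := EM (val i <> 1%N /\ val j <> 1%N).
  by exists (@K 1%N isT); split; exact: nK.
by move=> h1 h0; exists (@K 2%N isT); split; apply: nK; lia.
Qed.

Section Arc.
Context {R : realType} {X : topologicalType} (f : R -> X).
Hypothesis fc : {within `[0, 1], continuous f}.

Lemma arc_same_side m a b : 0 <= a -> a <= b -> b <= 1 ->
  (forall t, a <= t -> t <= b -> f t <> m) -> same_side m (f a) (f b).
Proof.
move=> a0 ab b1 fm; apply: (@connected_same_side _ (f @` `[a, b])).
- apply: connected_continuous_connected; first exact: segment_connected.
  apply: continuous_subspaceW fc; apply: subset_itv; by rewrite bnd_simp.
- by move=> [t /=]; rewrite in_itv /= => /andP[at_ tb] ft; exact: fm ft.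
- by exists a => //=; rewrite in_itv /= lexx.
- by exists b => //=; rewrite in_itv /= lexx ab.
Qed.

Lemma arc_separator m a b : 0 <= a -> a <= b -> b <= 1 ->
  ~ same_side m (f a) (f b) -> exists t, [/\ a <= t, t <= b & f t = m].
Proof.
move=> a0 ab b1 h; apply: contrapT => nt; apply: h; apply: arc_same_side => //.
by move=> t at_ tb ft; apply: nt; exists t.
Qed.
End Arc.

Lemma color_two (n : option nat) : at_least_3 n -> exists i j : color n, i <> j.
Proof.
move=> n3; have c0 : is_color n 0 by case: n n3 => //= -[].
have [k [k0 _]] := color_other2 (exist _ 0%N c0) (exist _ 0%N c0) n3.
by exists k, (exist _ 0%N c0).
Qed.

Lemma branch_point_of3 (X : topologicalType) (m : X) (v : 'I_3 -> X) :
  (forall i, v i <> m) -> (forall i j, i != j -> ~ same_side m (v i) (v j)) ->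
  branch_point m.
Proof.
move=> vm vs; have /injfunPex[f] : exists2 f : nat -> set X,
    set_fun `I_3 (components_at m) f & set_inj `I_3 f.
  exists (fun k => component_at m (v (inord k))).
    by move=> k _; exists (v (inord k)) => //; exact: vm.
  move=> k l /set_mem /= k3 /set_mem /= l3 e; apply/eqP/negPn/negP => kl.
  apply: (vs (inord k) (inord l)); last by apply/same_sideE.
  by rewrite -val_eqE /= !inordK.
exact: inj_card_le.
Qed.

Lemma compact_metrizable_separable (R : realType) (X : topologicalType) (p : X) :
  compact [set: X] -> metrizable R X ->
  exists q : nat * nat -> X, forall U : set X, open U -> U !=set0 -> exists k, U (q k).
Proof.
move=> cX [d [d0 dE dC _ dn]].
have net (k : nat) : exists s : seq X, forall x, exists2 y, y \in s & d y x < k.+1%:R^-1.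
  apply: contrapT => h.
  have [|s _|x /(_ x I)] := @compact_finite_intersection X X setT
    (fun y => ~` [set z | d y z < k.+1%:R^-1]°) cX.
  - by move=> y _; apply: open_closedC; exact: open_interior.
  - apply: contrapT => hs; apply: h; exists s => x; apply: contrapT => hx.
    apply: hs; exists x => y ys; move=> /interior_subset /= dyx; apply: hx.
    by exists y.
  - by apply; apply/dn; exists k.+1%:R^-1 => //; rewrite invr_gt0.
have [s sP] := choice net; exists (fun k => nth p (s k.1) k.2) => U oU [x Ux].
have /dn[e e0 eU] := open_nbhs_nbhs (conj oU Ux).
have [k ke] : exists k : nat, k.+1%:R^-1 < e.
  by exists (Num.trunc e^-1); rewrite invf_plt ?posrE // truncnS_gt.
have [y ys dyx] := sP k x; exists (k, index y (s k)) => /=.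
by rewrite nth_index //; apply: eU; rewrite /= dC; exact: lt_trans ke.
Qed.

Lemma nbhs_seq (T : topologicalType) (I : eqType) (p : T) (U : I -> set T) (s : seq I) :
  (forall i, i \in s -> nbhs p (U i)) -> nbhs p [set x | forall i, i \in s -> U i x].
Proof.
elim: s => [|i s IH] h; first by apply: filterS filterT.
have hi := h i (mem_head _ _).
have hs := IH (fun j js => h j (mem_behead (s := i :: s) js)).
apply: filterS (filterI hi hs) => x [Ui Us] j; rewrite in_cons.
by case/predU1P=> [->//|/Us].
Qed.

Section Triangle.
Context {T : Type} (h : T -> T -> int).
Hypothesis h_anti : forall i j, h i j = - h j i.

(** The coboundary of [h]: since [h] is alternating, the last term is [- h i k]. *)
Definition triangle i j k : int := h i j + h j k + h k i.

Lemma triangle_neq i j k : triangle i j k <> 0 -> [/\ i <> j, i <> k & j <> k].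
Proof.
have hxx x : h x x = 0 by have := h_anti x x; lia.
rewrite /triangle => t0; split=> e; subst; apply: t0.
- by rewrite hxx (h_anti k); lia.
- by rewrite hxx (h_anti j); lia.
- by rewrite hxx (h_anti i); lia.
Qed.

Lemma triangle_flip i j k : triangle j i k = - triangle i j k.
Proof. by rewrite /triangle (h_anti j i) (h_anti i k) (h_anti k j); lia. Qed.

Lemma triangle_cocycle i j k l :
  triangle j k l - triangle i k l + triangle i j l - triangle i j k = 0.
Proof.
rewrite /triangle (h_anti l j) (h_anti l i) (h_anti k i); lia.
Qed.

Lemma triangle_bound i j k : (forall i j, `|h i j| <= 1) -> `|triangle i j k| <= 3.
Proof.
move=> h1; have := h1 i j; have := h1 j k; have := h1 k i; rewrite /triangle; lia.
Qed.

End Triangle.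

Section Kaleidoscope.
Context {R : realType} {n : option nat} {X : topologicalType} (c : coloring n X).
Hypothesis n3 : at_least_3 n.
Hypothesis wX : wazewski R n X.
Hypothesis kc : kaleidoscopic R c.

Definition kap (z x : X) := c z (component_at z x).

Let closed1 (x : X) : closed [set x].
Proof. by case: wX => -[[_ _ _ mX] _] _ _ _; exact: (metrizable_closed1 mX). Qed.
Let lcX : locally_connected X.
Proof. by case: wX => -[_ []]. Qed.
Let cptX : compact [set: X].
Proof. by case: wX => -[[]]. Qed.
Let cX : connected [set: X].
Proof. by case: wX => -[[]]. Qed.

Lemma kapP z x y : branch_point z -> x <> z -> y <> z ->
  kap z x = kap z y <-> same_side z x y.
Proof.
move=> bz xz yz; rewrite same_sideE //; split; last by rewrite /kap => ->.
have [_ cinj _] := col_bij c bz.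
by apply: cinj; apply/mem_set; [exists x|exists y].
Qed.

Lemma kap_surj z i : branch_point z -> exists2 x, x <> z & kap z x = i.
Proof.
move=> bz; have [_ _ cs] := col_bij c bz.
by have [_ [x xz <-] <-] := cs i I; exists x.
Qed.

Lemma kap_tree z z' x : branch_point z -> branch_point z' ->
  z <> z' -> x <> z -> x <> z' -> kap z x = kap z z' \/ kap z' x = kap z' z.
Proof.
move=> bz bz' zz' xz xz'.
have [h|h] := @same_side_tree _ closed1 lcX cX z z' x zz'; [left|right];
  by apply/kapP => //; exact: nesym.
Qed.

(** * Colors along arcs *)

Definition arc_param (x y : X) (f : R -> X) :=
  [/\ {within `[0, 1], continuous f},
      forall s t, 0 <= s <= 1 -> 0 <= t <= 1 -> f s = f t -> s = t,
      f 0 = x & f 1 = y].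

(** As [arc] is empty when no arc exists, the branch point on the open arc given by [wazewski] also
    proves that there is an arc. *)
Lemma exists_arc x y : x <> y -> exists2 f, arc_param x y f &
  exists t, [/\ 0 < t, t < 1 & branch_point (f t)].
Proof.
move=> xy; case: wX => _ _ _ /(_ x y xy) [u [[+ ux] bu]].
rewrite /Defs.arc; case: xgetP => //= S _ [f [[g [cf cg fK gK]] f0 f1]] Su.
have [gu fgu] := gK _ Su; exists f.
  split=> // s t s01 t01 e.
  by have [_ <-] := fK s s01; have [_ <-] := fK t t01; rewrite e.
move: gu; rewrite /= in_itv /= => /andP[g0 g1].
exists (g u); rewrite fgu; split=> //; rewrite lt_neqAle ?g0 ?g1 andbT;
  apply/eqP => e; apply: ux; [left|right]; rewrite /= -fgu.
  by rewrite -e f0.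
by rewrite e f1.
Qed.

(** The point [z] given by [kaleidoscopic] on the chosen arc from [f a] to [f b] separates these two
    points, so [f] passes through it. Before [a] and after [b], the path stays on the sides of [f a]
    and [f b]. *)
Lemma arc_param_between x y f a b i j : arc_param x y f ->
  0 <= a -> a < b -> b <= 1 -> branch_point (f a) -> branch_point (f b) ->
  i <> j -> exists t, [/\ a < t, t < b, branch_point (f t),
    kap (f t) x = i & kap (f t) y = j].
Proof.
move=> [cf fi f0 f1] a0 ab b1 ba bb ij.
have fab : f a <> f b.
  move=> e; suff : a = b by lra.
  by apply: fi => //; lra.
have [z [[_ zab] bz za zb]] := kc ba bb fab ij.
have [fza fzb] : f a <> z /\ f b <> z.
  by split=> e; apply: zab; [left|right].
have [||||t [at_ tb ft]] := @arc_separator _ _ f cf z a b => //.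
- exact: ltW.
- by move/kapP => /(_ bz fza fzb); rewrite /kap za zb.
have ta : a < t.
  by rewrite lt_neqAle at_ andbT; apply/eqP => e; apply: fza; rewrite e.
have tb' : t < b.
  by rewrite lt_neqAle tb andbT; apply/eqP => e; apply: fzb; rewrite -e.
exists t; rewrite ft; split=> //.
  rewrite -za -f0; have fz0 s : 0 <= s -> s <= a -> f s <> z.
    move=> s0 sa fs; suff : s = t by lra.
    by apply: fi; rewrite ?fs ?ft //; lra.
  apply/kapP => //; first by apply: fz0.
  by apply: arc_same_side => //; lra.
rewrite -zb -f1; have fz1 s : b <= s -> s <= 1 -> f s <> z.
  move=> s0 sa fs; suff : s = t by lra.
  by apply: fi; rewrite ?fs ?ft //; lra.
apply/kapP => //; first by apply: fz1.
by apply: same_side_sym; apply: arc_same_side => //; lra.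
Qed.

(** One branch point [f a] on the arc [f] is given, and [arc_param_between] needs two. An arc [g]
    from [x] to [f a] is not known to be part of [f], but it contains a branch point separating its
    ends, which [f] must pass. *)
Lemma kap_dense x y i j : x <> y -> i <> j ->
  exists z, [/\ branch_point z, z <> x, z <> y, kap z x = i & kap z y = j].
Proof.
move=> xy ij; have [f fP [a [a0 a1 ba]]] := exists_arc xy.
have [cf fi f0 f1] := fP.
have xa : x <> f a.
  rewrite -f0 => /fi h; suff : 0 = a by lra.
  by apply: h; lra.
have [g gP [b [b0 b1 bb]]] := exists_arc xa; have [cg gi g0 g1] := gP.
have ba' : branch_point (g 1) by rewrite g1.
have [s [bs s1 bgs sx sa]] := arc_param_between gP (ltW b0) b1 (lexx 1) bb ba' ij.
have gsx : x <> g s.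
  rewrite -g0 => /gi h; suff : 0 = s by lra.
  by apply: h; lra.
have gsa : f a <> g s.
  rewrite -g1 => /gi h; suff : 1 = s by lra.
  by apply: h; lra.
have [||||t [t0 ta ft]] := @arc_separator _ _ f cf (g s) 0 a => //.
- exact: ltW.
- exact: ltW.
- by rewrite f0; move/kapP => /(_ bgs gsx gsa); rewrite sx sa.
have ta' : t < a.
  by rewrite lt_neqAle ta andbT; apply/eqP => e; apply: gsa; rewrite -e.
have bft : branch_point (f t) by rewrite ft.
have [r [tr ra br rx ry]] := arc_param_between fP t0 ta' (ltW a1) bft ba ij.
exists (f r); split=> //.
  rewrite -f0 => /fi h; suff : r = 0 by lra.
  by apply: h; lra.
rewrite -f1 => /fi h; suff : r = 1 by lra.
by apply: h; lra.
Qed.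

Lemma exists_separator (x y : X) : x <> y ->
  exists m, [/\ branch_point m, m <> x, m <> y & ~ same_side m x y].
Proof.
move=> xy; have [i [j ij]] := color_two n3.
have [z [bz zx zy kx ky]] := kap_dense xy ij.
exists z; split=> // /kapP h; apply: ij; rewrite -kx -ky; apply: h => //;
  exact: nesym.
Qed.

Lemma three_sides (z : X) : branch_point z -> exists v : 'I_3 -> X,
  (forall i, v i <> z) /\ (forall i j, i != j -> ~ same_side z (v i) (v j)).
Proof.
move=> bz; have [i [j ij]] := color_two n3; have [k [ki kj]] := color_other2 i j n3.
have vP (l : 'I_3) : exists x, x <> z /\ kap z x = nth i [:: i; j; k] l.
  by have [x xz <-] := kap_surj (nth i [:: i; j; k] l) bz; exists x.
have [v vz] := choice vP; exists v; split=> [l|l m lm]; first by case: (vz l).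
have [vl cl] := vz l; have [vm cm] := vz m.
move=> /(kapP bz vl vm); rewrite cl cm.
case: l lm {vl cl} => -[|[|[|//]]] l3; case: m {vm cm} => -[|[|[|//]]] m3 //= _;
  congruence.
Qed.

(** Three points of a countable dense set on distinct sides of [z] determine [z]: for [z'] other
    than [z], at most one of them is on the side of [z] containing [z'], so at least two are on the
    side of [z'] containing [z]. *)
Lemma countable_branch_point : countable (@branch_point X).
Proof.
have [[x0 _] _ _ mX] : [/\ [set: X] !=set0, compact [set: X],
  connected [set: X] & metrizable R X] by case: wX => -[].
have [q qd] := compact_metrizable_separable x0 cptX mX.
have codeP z : exists k : {ffun 'I_3 -> nat * nat}, branch_point z ->
    (forall i, q (k i) <> z) /\
    (forall i j, i != j -> ~ same_side z (q (k i)) (q (k j))).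
  have [bz|] := EM (branch_point z); last by exists [ffun=> (0, 0)%N].
  have [v [vz vs]] := three_sides bz.
  have kP i : exists k, same_side z (v i) (q k).
    have [|k] := qd _ (open_same_side closed1 lcX z (v i)).
      by exists (v i); exact: same_side_refl.
    by exists k.
  have [k kv] := choice kP; exists [ffun i => k i] => _.
  split=> [i|i j ij]; rewrite !ffunE; first exact: same_side_neqr (kv i).
  move=> h; apply: (vs i j ij); apply: same_side_trans (kv i) _.
  exact: same_side_trans h (same_side_sym (kv j)).
have [code cP] := choice codeP.
apply/countable_injP; exists (fun z => choice.pickle (code z)).
move=> z z' /set_mem bz /set_mem bz' /(pcan_inj choice.pickleK) e.
apply: contrapT => zz'; have [kz ks] := cP z bz; have [kz' ks'] := cP z' bz'.
rewrite -e in kz' ks'; set k := code z in kz ks kz' ks'.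
have [[i hi]|nh] := EM (exists i, same_side z (q (k i)) z'); last first.
  have h i : same_side z' (q (k i)) z.
    have [h|//] := @same_side_tree _ closed1 lcX cX z z' (q (k i)) zz'.
    by exfalso; apply: nh; exists i.
  by apply: (ks' 0 1) => //; exact: same_side_trans (h 0) (same_side_sym (h 1)).
have [j [l [jl ji li]]] := ord3_others i.
have h l' : l' != i -> same_side z' (q (k l')) z.
  move=> li'; have [h|//] := @same_side_tree _ closed1 lcX cX z z' (q (k l')) zz'.
  by exfalso; apply: (ks _ _ li'); exact: same_side_trans h (same_side_sym hi).
exact: (ks' _ _ jl) (same_side_trans (h _ ji) (same_side_sym (h _ li))).
Qed.

(** An arc has uncountably many points, as []0, 1[] has positive Lebesgue measure, and only
    countably many of them are branch points. *)
Lemma exists_nonbranch (z : X) i : branch_point z ->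
  exists q, [/\ ~ branch_point q, q <> z & kap z q = i].
Proof.
move=> bz; have [x xz <-] := kap_surj i bz.
have [f [cf fi f0 f1] _] := exists_arc xz.
have ft (t : R) : 0 < t -> t < 1 -> f t <> z /\ kap z (f t) = kap z x.
  move=> t0 t1; have fz (s : R) : 0 <= s -> s <= t -> f s <> z.
    move=> s0 st; rewrite -f1 => e; suff : s = 1 by lra.
    by apply: fi => //; lra.
  have ftz : f t <> z by apply: fz; lra.
  split=> //; apply/kapP => //; apply: same_side_sym; rewrite -f0.
  by apply: arc_same_side => //; lra.
apply: contrapT => h; have bf (t : R) : 0 < t -> t < 1 -> branch_point (f t).
  move=> t0 t1; apply: contrapT => nb; apply: h; exists (f t).
  by have [] := ft t t0 t1; split.
have /countable_injP[g gi] := countable_branch_point.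
have : countable (`]0, 1[ : set R).
  apply/countable_injP; exists (g \o f) => s t /set_mem /=.
  rewrite in_itv /= => /andP[s0 s1] /set_mem /=; rewrite in_itv /= => /andP[t0 t1].
  move=> /gi e; apply: fi; [lra|lra|].
  by apply: e; apply/mem_set; exact: bf.
move=> /countable_lebesgue_measure0; rewrite lebesgue_measure_itv /= lte_fin ltr01.
by rewrite -EFinB subr0 => -[] /eqP; rewrite oner_eq0.
Qed.

(** * The colored tree of branch points *)

Notation Br := (set_type (@branch_point X)).

Definition kapB (z x : Br) := kap (val z) (val x).

Let BrP (z : X) : branch_point z -> exists b : Br, val b = z.
Proof. by move=> bz; exists (SigSub (mem_set bz)). Qed.

Let val_neq (x y : Br) : x <> y -> val x <> val y.
Proof. by move=> xy /val_inj. Qed.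

Lemma colored_tree_branch : colored_tree kapB.
Proof.
split.
- move=> z z' x /val_neq zz' /val_neq xz /val_neq xz'.
  exact: (kap_tree (set_valP z) (set_valP z')).
- move=> x y i j /val_neq xy ij.
  have [z [bz zx zy kx ky]] := kap_dense xy ij; have [b bE] := BrP bz.
  by exists b; split; rewrite /kapB ?bE // => e; [apply: zx|apply: zy]; rewrite -e.
- move=> z i; have [x xz kx] := kap_surj i (set_valP z).
  have [k [l kl]] := color_two n3.
  have [m [bm mx mz kmx kmz]] := kap_dense xz kl; have [b bE] := BrP bm.
  exists b; first by move=> e; apply: mz; rewrite -bE e.
  rewrite /kapB bE -kx; have zm := nesym mz; have xm := nesym mx.
  case: (kap_tree (set_valP z) bm zm xz xm) => [//|].
  by rewrite kmx kmz.
- move=> x y w /val_neq xy /val_neq xw /val_neq yw kx ky kw.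
  pose v (k : 'I_3) := nth (val x) [:: val x; val y; val w] k.
  have ss (a b d : Br) : val b <> val a -> val d <> val a -> kapB a b = kapB a d ->
      same_side (val a) (val b) (val d).
    by move=> ba da /kapP; apply=> //; exact: set_valP.
  have v_inj : injective v.
    move=> [[|[|[|//]]] h] [[|[|[|//]]] h']; rewrite /v /= => e;
      first [exact: val_inj | by case: xy | by case: xw | by case: yw].
  have v_end i j k : i != j -> i != k -> j != k -> same_side (v k) (v i) (v j).
    by case: i j k => [[|[|[|//]]] h] [[|[|[|//]]] h'] [[|[|[|//]]] h''] //= _ _ _;
      rewrite /v /=; apply: ss => //; (exact: nesym || exact: esym).
  have sepX (a b : X) : a <> b -> exists m, [/\ m <> a, m <> b & ~ same_side m a b].
    by move=> /exists_separator[m [_ ma mb h]]; exists m.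
  have [m [mv ms]] := exists_median closed1 lcX cX sepX v_inj v_end.
  have bm : branch_point m by apply: branch_point_of3 ms => k; exact: nesym.
  have [b bE] := BrP bm; exists b.
  have bv k : val b <> v k by rewrite bE.
  have bs k l : k != l -> kap (val b) (v k) <> kap (val b) (v l).
    move=> kl /kapP; rewrite bE => h; apply: (ms k l kl); apply: h => //; exact: nesym.
  split; split; first [by move=> e; apply: (bv 0); rewrite e
    |by move=> e; apply: (bv 1); rewrite e|by move=> e; apply: (bv 2); rewrite e
    |exact: (bs 0 1)|exact: (bs 0 2)|exact: (bs 1 2)].
- by move=> i; have [j []] := color_other2 i i n3; exists j.
Qed.

Lemma exists_branch_enum : exists e : nat -> Br, forall x, exists k, e k = x.
Proof.
have /countable_injP[g gi] := countable_branch_point.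
have [b0 _] : exists b : Br, True.
  case: wX => _ [x [y xy]] _ _; have [m [bm _ _ _]] := exists_separator xy.
  by have [b _] := BrP bm; exists b.
exists (fun k => xget b0 [set b | g (val b) = k]) => x; exists (g (val x)).
apply: xget_unique => // y /= e; apply/val_inj/gi => //; exact: valP.
Qed.

(** By compactness: otherwise some [y] outside the interior of [V], hence other than [q], would not
    be separated from [q] by any branch point. *)
Lemma nbhs_sides (q : X) (V : set X) : nbhs q V -> exists s : seq X,
  (forall z, z \in s -> branch_point z /\ z <> q) /\
  (forall q', (forall z, z \in s -> same_side z q q') -> V q').
Proof.
move=> qV; apply: contrapT => h.
pose D : set X := [set z | branch_point z /\ z <> q].
pose F (z : X) : set X := [set y | ~ V° y /\ (same_side z q y \/ y = z)].
have [x xq] : exists x, x <> q.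
  case: wX => _ [x [y xy]] _ _; have [xq|] := EM (x = q); last by exists x.
  by exists y; rewrite -xq; exact: nesym.
(* With [D] inhabited by [z0], a point common to all [F z] is outside the interior of [V]. *)
have [z0 [bz0 z0x z0q _]] := exists_separator xq.
have clF z : D z -> closed (F z).
  move=> _; rewrite (_ : F z = ~` (V° `|` [set y | y <> z /\ ~ same_side z q y])).
    apply: open_closedC; apply: openU; first exact: open_interior.
    rewrite openE => y [yz nqy].
    have : nbhs y (same_side z y).
      apply: open_nbhs_nbhs; split; last exact: same_side_refl.
      exact: open_same_side.
    apply: filterS => y' yy'; split; first exact: same_side_neqr yy'.
    by move=> qy'; apply: nqy; exact: same_side_trans qy' (same_side_sym yy').
  apply/seteqP; split=> y /=.
    by move=> [nV qy] [//|[yz nqy]]; case: qy.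
  move=> /not_orP[nV nz]; split=> //.
  by have [|yz] := EM (y = z); [right|left; apply: contrapT => nqy; apply: nz].
have [|y yF] := compact_finite_intersection cptX clF.
  move=> s sD; apply: contrapT => hs; apply: h; exists s; split=> // q' qq'.
  apply: contrapT => nV; apply: hs; exists q' => z zs; split; last by left; exact: qq'.
  by move/interior_subset.
have [nVy _] := yF z0 (conj bz0 z0q).
have qy : q <> y by move=> qy; apply: nVy; rewrite -qy.
have [m [bm mq my nqy]] := exists_separator qy.
by have [_ [|/esym]] := yF m (conj bm mq).
Qed.

(** As [X] has no isolated point, a connected open neighborhood of [p] inside [U] has another point,
    and it contains any branch point that separates the two. *)
Lemma nbhs_branch (p : X) (U : set X) : nbhs p U -> exists2 m, branch_point m & U m.
Proof.
move=> /lcX[V [oV Vp cV VU]].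
have [y [Vy yp]] : exists y, V y /\ y <> p.
  apply: contrapT => h; have Vp' : V = [set p].
    apply/seteqP; split=> [y Vy|_ ->//]; apply: contrapT => yp.
    by apply: h; exists y.
  have all y : y = p.
    have : V y by apply: connected_clopen Vp => //; rewrite Vp'; exact: closed1.
    by rewrite Vp'.
  by case: wX => _ [x [y xy]] _ _; apply: xy; rewrite (all x) (all y).
have [m [bm my mp ns]] := exists_separator yp.
exists m => //; apply: VU; apply: contrapT => Vm; apply: ns.
exact: (connected_same_side cV).
Qed.

(** All local actions are trivial, so homeomorphisms of this kind are in
    [kaleidoscopic_group c Gamma] for every [Gamma]. *)
Definition color_preserving (a : X -> X) :=
  forall z x, branch_point z -> x <> z -> kap (a z) (a x) = kap z x.

Lemma color_preserving_continuous (a a' : X -> X) : cancel a a' -> cancel a' a ->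
  (forall z, branch_point z -> branch_point (a z)) ->
  (forall z, branch_point z -> branch_point (a' z)) ->
  color_preserving a -> continuous a.
Proof.
move=> aK a'K ab a'b ca p V /nbhs_sides[s [sb sV]].
have : nbhs p [set p' | forall z, z \in s -> same_side (a' z) p p'].
  apply: nbhs_seq => z zs; apply: open_nbhs_nbhs; split; first exact: open_same_side.
  by apply: same_side_refl => e; case: (sb _ zs) => _; rewrite e a'K.
apply: filterS => p' h; apply: sV => z zs; have [bz zp] := sb _ zs.
have hz := h _ zs; have pz := same_side_neql hz; have p'z := same_side_neqr hz.
have ne x : x <> a' z -> a x <> z by move=> xz e; apply: xz; rewrite -e aK.
apply/(kapP bz); try exact: ne.
by rewrite -(a'K z) !ca //; try exact: a'b; apply/kapP => //; exact: a'b.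
Qed.

(** * The action of the kaleidoscopic group *)

Context (Gamma : subgroup (sym (color n))).
Notation G := (kaleidoscopic_group c Gamma).

Definition app (g : G) (x : X) : X := val (val g) x.

Lemma app_inj (g h : G) : app g =1 app h -> g = h.
Proof. by move=> gh; do 2!apply: val_inj; exact: sym_eqP. Qed.

Lemma appM (g h : G) x : app (g * h)%g x = app g (app h x).
Proof. by []. Qed.

Lemma appK (g : G) : cancel (app g) (app g^-1%g).
Proof. by move=> x; rewrite -appM mulVg. Qed.

Lemma appVK (g : G) : cancel (app g^-1%g) (app g).
Proof. by move=> x; rewrite -appM mulgV. Qed.

Lemma app_injective (g : G) : injective (app g).
Proof. exact: can_inj (appK g). Qed.

Let homeoP (g : G) : homeo_set (val (val g)).
Proof. exact: set_mem (valP (val g)). Qed.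

Lemma app_branch (g : G) x : branch_point (app g x) <-> branch_point x.
Proof. exact: branch_point_homeo. Qed.

Lemma app_kap (g : G) z : branch_point z -> exists2 s, subgroup_set Gamma s &
  forall x, x <> z -> kap (app g z) (app g x) = s (kap z x).
Proof.
move=> bz; have := set_mem (valP g) z bz => -[s Gs].
move=> /(local_actionP c _ (homeoP g) bz) h; exists s => // x xz.
by rewrite -h; [rewrite image_component_at|exists x].
Qed.

Lemma exists_app (a a' : X -> X) : cancel a a' -> cancel a' a ->
  (forall z, branch_point z -> branch_point (a z)) ->
  (forall z, branch_point z -> branch_point (a' z)) ->
  color_preserving a -> exists g : G, app g =1 a.
Proof.
move=> aK a'K ab a'b ca.
have ca' : color_preserving a'.
  move=> z x bz xz; rewrite -[z in RHS]a'K -[x in RHS]a'K ca //; first exact: a'b.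
  by move=> /(can_inj a'K).
pose s : sym X := Sym aK a'K.
have hs : homeo_set s by split; [exact: (@color_preserving_continuous a a')|
  exact: (@color_preserving_continuous a' a)].
pose h : homeo X := exist _ s (mem_set hs).
have kh : kaleidoscopic_set c Gamma h.
  move=> z bz; exists 1%g; first by have [/set_mem] := subgroup_closed Gamma.
  apply/(local_actionP c _ hs bz) => _ [x xz <-].
  by rewrite (image_component_at _ _ hs); exact: ca.
by exists (exist _ h (mem_set kh)).
Qed.

(* [q] is the value at [p] of the continuous extension of [f] to [X]. *)
Definition corresponds (f : Br -> Br) (p q : X) := forall b : Br, val b <> p ->
  q <> val (f b) /\ kap (val (f b)) q = kap (val b) p.

(** * Extension of automorphisms of the colored tree to homeomorphisms *)

Section Extension.
Context (f f' : Br -> Br).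
Hypothesis fK : cancel f f'.
Hypothesis f'K : cancel f' f.
Hypothesis fc : forall z x, x <> z -> kapB (f z) (f x) = kapB z x.

Let f_onto (z : X) : branch_point z -> exists b : Br, val (f b) = z.
Proof. by move=> bz; exists (f' (SigSub (mem_set bz))); rewrite f'K. Qed.

Lemma corresponds_branch b : corresponds f (val b) (val (f b)).
Proof.
move=> b' b'b; have bb' : b <> b' by move=> e; apply: b'b; rewrite e.
split; last exact: fc.
by move=> /val_inj /(can_inj fK) /esym e; apply: b'b; rewrite e.
Qed.

Lemma corresponds_branch_eq b q : corresponds f (val b) q -> q = val (f b).
Proof.
move=> bq; apply: contrapT => /(exists_separator)[m [bm mq mb ns]].
have [b' b'E] := f_onto bm; subst m.
have b'b : val b' <> val b by move=> /val_inj e; apply: mb; rewrite e.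
have [q1 q2] := bq _ b'b; have [r1 r2] := corresponds_branch b'b.
by apply: ns; apply/(kapP bm) => //; rewrite q2 r2.
Qed.

Lemma corresponds_uniq p q q' : corresponds f p q -> corresponds f p q' -> q = q'.
Proof.
move=> pq pq'; apply: contrapT => /(exists_separator)[m [bm mq mq' ns]].
have [b bE] := f_onto bm; subst m; have [bp|bp] := EM (val b = p).
  by apply: mq; rewrite [RHS](@corresponds_branch_eq b) // bp.
have [q1 q2] := pq _ bp; have [r1 r2] := pq' _ bp.
by apply: ns; apply/(kapP bm) => //; rewrite q2 r2.
Qed.

Lemma corresponds_sym p q : corresponds f p q -> corresponds f' q p.
Proof.
move=> pq b bq; have [e|e] := EM (val (f' b) = p).
  case: bq; move: pq; rewrite -e => /corresponds_branch_eq ->.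
  by rewrite f'K.
by have [_ h] := pq _ e; split; [exact: nesym|rewrite -h f'K].
Qed.

(** If [p] is not a branch point, any finite set of conditions on [q] is met by the image of a
    branch point close to [p], and compactness gives all of them. *)
Lemma corresponds_exists p : exists q, corresponds f p q.
Proof.
have [bp|np] := EM (branch_point p).
  by exists (val (f (SigSub (mem_set bp)))); exact: (corresponds_branch (b := SigSub _)).
have pb (b : Br) : p <> val b by move=> e; apply: np; rewrite e; exact: set_valP.
(* Admitting [q = val (f b)] makes the set closed; this case is excluded below by a branch point
   separating [p] from [b]. *)
pose F (b : Br) : set X :=
  [set q | q = val (f b) \/ kap (val (f b)) q = kap (val b) p].
have clF b : setT b -> closed (F b).
  move=> _; rewrite (_ : F b = ~` [set q | q <> val (f b) /\
      kap (val (f b)) q <> kap (val b) p]); last first.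
    by apply/seteqP; split=> q /=; [case=> ? []|rewrite not_andE !notK].
  apply: open_closedC; rewrite openE => q [qb kq].
  have : nbhs q (same_side (val (f b)) q).
    apply: open_nbhs_nbhs; split; last exact: same_side_refl.
    exact: open_same_side.
  apply: filterS => q' qq'; have q'b := same_side_neqr qq'; split=> //.
  by move/(kapP (set_valP (f b)) qb q'b): qq' => <-.
have [|q qF] := compact_finite_intersection cptX clF.
  move=> s _.
  have np' : nbhs p [set p' | forall b, b \in s -> same_side (val b) p p'].
    apply: nbhs_seq => b _; apply: open_nbhs_nbhs; split.
      exact: open_same_side.
    exact: same_side_refl.
  have [m bm ms] := nbhs_branch np'.
  pose b0 : Br := SigSub (mem_set bm); exists (val (f b0)) => b bs; right.
  have pb0 := ms _ bs.
  have b0b : val b0 <> val b by exact: same_side_neqr pb0.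
  have [_ ->] := corresponds_branch (nesym b0b).
  by apply/(kapP (set_valP b)) => //; exact: same_side_sym.
exists q => b bp; have qb : q <> val (f b).
  move=> qb; have [m [bm mp mb ns]] := exists_separator (nesym bp).
  pose d : Br := SigSub (mem_set bm).
  have db : val d <> val b by [].
  have [bd kb] := corresponds_branch db.
  case: (qF d I) => [|kq]; first by rewrite qb.
  apply: ns; apply: same_side_sym; apply/(kapP bm); try exact: nesym.
  by rewrite -[LHS]kb -[RHS]kq qb.
by split=> //; have [|] := qF b I.
Qed.

End Extension.

Lemma exists_app_extension (f f' : Br -> Br) : cancel f f' -> cancel f' f ->
  (forall z x, x <> z -> kapB (f z) (f x) = kapB z x) ->
  exists2 g : G, color_preserving (app g) & forall b : Br, app g (val b) = val (f b).
Proof.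
move=> fK f'K fc.
have f'c z x : x <> z -> kapB (f' z) (f' x) = kapB z x.
  by move=> xz; rewrite -fc ?f'K // => /(can_inj f'K).
have [a af] := choice (corresponds_exists fK fc).
have [a' af'] := choice (corresponds_exists f'K f'c).
have aK : cancel a a'.
  move=> p; apply: (corresponds_uniq f'K fK f'c (af' _)).
  exact: corresponds_sym (af p).
have a'K : cancel a' a.
  move=> p; apply: (corresponds_uniq fK f'K fc (af _)).
  exact: corresponds_sym (af' p).
have aE (b : Br) : a (val b) = val (f b) by exact: corresponds_branch_eq (af _).
have a'E (b : Br) : a' (val b) = val (f' b) by exact: corresponds_branch_eq (af' _).
have [|||||g gE] := @exists_app a a' => //.
- move=> z bz; rewrite -[z]/(val (SigSub (mem_set bz) : Br)) aE; exact: set_valP.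
- move=> z bz; rewrite -[z]/(val (SigSub (mem_set bz) : Br)) a'E; exact: set_valP.
- move=> z x bz xz; rewrite -[z]/(val (SigSub (mem_set bz) : Br)) aE.
  by have [|_ ->] := af x (SigSub (mem_set bz)); first exact: nesym.
exists g => [z x bz xz|b]; last by rewrite gE aE.
rewrite !gE -[z]/(val (SigSub (mem_set bz) : Br)) aE.
by have [|_ ->] := af x (SigSub (mem_set bz)); first exact: nesym.
Qed.

Lemma app_homogeneous (y t y' t' : X) : branch_point y -> branch_point t ->
  branch_point y' -> branch_point t' -> y <> t -> y' <> t' ->
  kap y t = kap y' t' -> kap t y = kap t' y' ->
  exists g : G, [/\ color_preserving (app g), app g y = y' & app g t = t'].
Proof.
move=> by_ bt by' bt' yt yt' ky kt.
pose B z (bz : branch_point z) : Br := SigSub (mem_set bz).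
have [e eS] := exists_branch_enum.
have [||||f [f' [fK f'K fc fy ft]]] := colored_tree_homogeneous
  (colored_tree_branch) (y := B _ by_) (t := B _ bt) (y' := B _ by')
  (t' := B _ bt') eS => //.
- by move/(congr1 val).
- by move/(congr1 val).
have [g gc gE] := exists_app_extension fK f'K fc.
exists g; split=> //.
  by have := gE (B _ by_); rewrite fy.
by have := gE (B _ bt); rewrite ft.
Qed.

(** The last inequality says that [z] is between [a] and [b]. *)
Lemma kap_behind (a z b : X) : branch_point a -> branch_point z ->
  a <> z -> b <> a -> b <> z -> kap z a <> kap z b -> kap a b = kap a z.
Proof.
move=> ba bz az ba' bz' h; case: (kap_tree ba bz az ba' bz') => //.
by move=> e; case: h.
Qed.

Lemma color_preservingM (g h : G) : color_preserving (app g) ->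
  color_preserving (app h) -> color_preserving (app (g * h)%g).
Proof.
move=> cg ch z x bz xz; rewrite !appM cg ?ch //; first exact/app_branch.
by move=> /app_injective.
Qed.

Lemma color_preservingV (g : G) : color_preserving (app g) ->
  color_preserving (app g^-1%g).
Proof.
move=> cg z x bz xz; rewrite -[in RHS](appVK g z) -[in RHS](appVK g x) cg //.
  exact/app_branch.
by move=> /app_injective.
Qed.

Lemma color_preservingX (g : G) m : color_preserving (app g) ->
  color_preserving (app (g ^+ m)%g).
Proof.
move=> cg; elim: m => [|m IH]; first by rewrite expg0.
by rewrite expgS; exact: color_preservingM.
Qed.

Lemma app_same_side (g : G) z a b :
  same_side (app g z) (app g a) (app g b) <-> same_side z a b.
Proof.
have half (h : G) z' a' b' : same_side z' a' b' ->
    same_side (app h z') (app h a') (app h b').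
  move=> ab; have hh : homeo_set (val (val h)) by exact: set_mem (valP (val h)).
  by rewrite /same_side -(image_component_at _ _ hh); exists b'.
split; last exact: half.
by move/(half g^-1%g); rewrite !appK.
Qed.

Lemma side_stable (g : G) w y x : color_preserving (app g) -> branch_point w ->
  app g w = w -> same_side w y x -> same_side w y (app g x).
Proof.
move=> cg bw gw yx; have xw := same_side_neqr yx.
apply: same_side_trans (yx) _.
have gxw : app g x <> w by rewrite -[in RHS]gw => /app_injective.
by apply/(kapP bw) => //; rewrite -[in RHS]gw cg.
Qed.

(** * Gluing along disjoint sides *)

Section Family.
Context (I : Type) (w y : I -> X).
Hypothesis bw : forall i, branch_point (w i).
Hypothesis disj : forall i j x,
  same_side (w i) (y i) x -> same_side (w j) (y j) x -> i = j.

Let glue (k : I -> G) (x : X) : X :=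
  if pselect (exists i, same_side (w i) (y i) x) is left h
  then app (k (sval (cid h))) x else x.

Let glue_in k i x : same_side (w i) (y i) x -> glue k x = app (k i) x.
Proof.
move=> ix; rewrite /glue; case: pselect => [h|[]]; last by exists i.
by case: cid => j /= jx; rewrite (disj jx ix).
Qed.

Let glue_out k x : (forall i, ~ same_side (w i) (y i) x) -> glue k x = x.
Proof.
by move=> h; rewrite /glue; case: pselect => // h'; have [i /h] := h'.
Qed.

Lemma exists_glue (k : I -> G) : (forall i, color_preserving (app (k i))) ->
  (forall i, app (k i) (w i) = w i) ->
  exists g : G, [/\ color_preserving (app g),
    forall i x, same_side (w i) (y i) x -> app g x = app (k i) x &
    forall x, (forall i, ~ same_side (w i) (y i) x) -> app g x = x].
Proof.
move=> ck kw; pose k' i := (k i)^-1%g.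
have ck' i : color_preserving (app (k' i)) by exact: color_preservingV.
have kw' i : app (k' i) (w i) = w i by rewrite -[in LHS](kw i) appK.
have inP x : (exists i, same_side (w i) (y i) x) \/
    (forall i, ~ same_side (w i) (y i) x).
  by have [|h] := EM (exists i, same_side (w i) (y i) x); [left|right=> i hi;
    apply: h; exists i].
have canc l l' : (forall i, app (l i) (w i) = w i) ->
    (forall i, color_preserving (app (l i))) ->
    (forall i, cancel (app (l i)) (app (l' i))) -> cancel (glue l) (glue l').
  move=> lw cl ll' x; have [[i ix]|nx] := inP x; last by rewrite !glue_out.
  by rewrite (glue_in l ix) (glue_in l' (i := i)) ?ll' //; exact: side_stable.
have br l : forall z, branch_point z -> branch_point (glue l z).
  move=> z bz; have [[i iz]|nz] := inP z; last by rewrite glue_out.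
  by rewrite (glue_in l iz); exact/app_branch.
have cg : color_preserving (glue k).
  move=> z x bz xz; have [[i iz]|nz] := inP z.
    rewrite (glue_in k iz); have zw := same_side_neqr iz.
    (* Seen from inside the side at [w i], all points outside are in the direction of [w i], which
       [k i] fixes. *)
    have toward u x' : branch_point u -> same_side (w i) (y i) u ->
        ~ same_side (w i) (y i) x' -> x' <> u -> kap u x' = kap u (w i).
      move=> bu iu nx' x'u; have uw := same_side_neqr iu.
      have [h|h] := @same_side_tree _ closed1 lcX cX (w i) u x' (nesym uw).
        by case: nx'; exact: same_side_trans iu (same_side_sym h).
      by apply/(kapP bu) => //; exact: nesym.
    have [ix|nix] := EM (same_side (w i) (y i) x).
      by rewrite (glue_in k ix) ck.
    have ngx : ~ same_side (w i) (y i) (glue k x).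
      move=> h; apply: nix; have [[j jx]|nx] := inP x; last by rewrite -(glue_out k nx).
      rewrite (glue_in k jx) in h.
      by rewrite (disj h (side_stable (ck j) (bw j) (kw j) jx)).
    have ikz := side_stable (ck i) (bw i) (kw i) iz.
    rewrite !toward //; last by move=> e; apply: ngx; rewrite e.
      by rewrite -[in LHS](kw i) ck //; exact: nesym.
    exact/app_branch.
  rewrite (glue_out k nz); have [[i ix]|nx] := inP x; last by rewrite (glue_out k nx).
  rewrite (glue_in k ix); have ikx := side_stable (ck i) (bw i) (kw i) ix.
  apply/(kapP bz) => //; first by move=> e; apply: (nz i); rewrite -e.
  apply: (connected_same_side (S := same_side (w i) (y i))) => //.
  exact: component_connected.
have [|||||g gE] := @exists_app (glue k) (glue k').
- by apply: canc => // i; exact: appK.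
- by apply: canc => // i; exact: appVK.
- exact: br.
- exact: br.
- exact: cg.
exists g; split=> [z x bz xz|i x ix|x nx]; rewrite ?gE.
- exact: cg.
- exact: glue_in.
- exact: glue_out.
Qed.
End Family.

Lemma exists_restriction (w y : X) (k : G) : branch_point w ->
  color_preserving (app k) -> app k w = w ->
  exists g : G, [/\ color_preserving (app g),
    forall x, same_side w y x -> app g x = app k x &
    forall x, ~ same_side w y x -> app g x = x].
Proof.
move=> bw ck kw.
have [||||g [cg gi go]] := @exists_glue unit (fun=> w) (fun=> y) _ _ (fun=> k) => //.
  by move=> [] [].
by exists g; split=> // x; [exact: (gi tt)|move=> h; exact: go].
Qed.

(** * The cocycle [omega] *)

Context (h : color n -> color n -> int).
Hypothesis h_anti : forall i j, h i j = - h j i.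
Hypothesis h_inv : forall s, subgroup_set Gamma s -> forall i j, h (s i) (s j) = h i j.
Notation triangle := (triangle h).

Definition centers (p q r : X) : set X := [set z | branch_point z /\
  [/\ kap z p <> kap z q, kap z p <> kap z r & kap z q <> kap z r]].

(** Each of the three points is seen from [z] towards [z'] or from [z'] towards [z]; two of them
    fall under the same alternative and get equal colors. *)
Lemma centers_uniq p q r z z' : ~ branch_point p -> ~ branch_point q ->
  ~ branch_point r -> centers p q r z -> centers p q r z' -> z = z'.
Proof.
move=> np nq nr [bz [z1 z2 z3]] [bz' [z1' z2' z3']]; apply: contrapT => zz'.
have t x : ~ branch_point x -> kap z x = kap z z' \/ kap z' x = kap z' z.
  by move=> nx; apply: (kap_tree bz bz' zz') => xz; apply: nx; rewrite xz.
by case: (t p np) => ?; case: (t q nq) => ?; case: (t r nr) => ?; congruence.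
Qed.

Context (b0 : X).
Hypothesis bb0 : branch_point b0.

(* When there is no center, two of the three colors at [b0] agree, so that
   [triangle] vanishes there. *)
Definition center p q r := xget b0 (centers p q r).

Definition omega p q r : int :=
  let z := center p q r in triangle (kap z p) (kap z q) (kap z r).

Lemma center_branch p q r : branch_point (center p q r).
Proof. by rewrite /center; case: xgetP => // z _ []. Qed.

Lemma omega_eq p q r z : ~ branch_point p -> ~ branch_point q -> ~ branch_point r ->
  branch_point z -> triangle (kap z p) (kap z q) (kap z r) <> 0 ->
  omega p q r = triangle (kap z p) (kap z q) (kap z r) /\ center p q r = z.
Proof.
move=> np nq nr bz /(triangle_neq h_anti) zc.
have ze : center p q r = z.
  by apply: xget_unique => [//|y yc]; exact: (centers_uniq np nq nr yc).
by rewrite /omega ze.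
Qed.

(** The summand vanishes off the center. Summing over one set containing the centers of four triples
    reduces the cocycle identity for [omega] to that for [triangle]. *)
Lemma omega_sum (zs : seq X) p q r : ~ branch_point p -> ~ branch_point q ->
  ~ branch_point r -> uniq zs -> (forall z, z \in zs -> branch_point z) ->
  center p q r \in zs ->
  omega p q r = \sum_(z <- zs) triangle (kap z p) (kap z q) (kap z r).
Proof.
move=> np nq nr uzs bzs czs; rewrite (bigD1_seq _ czs uzs) /= big_seq_cond big1 ?addr0 //.
move=> z /andP[zs_ /eqP zc]; apply: contrapT => t0.
by have [_ /esym] := omega_eq np nq nr (bzs _ zs_) t0.
Qed.

Lemma omega_cocycle p q r s : ~ branch_point p -> ~ branch_point q ->
  ~ branch_point r -> ~ branch_point s ->
  omega q r s - omega p r s + omega p q s - omega p q r = 0.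
Proof.
move=> np nq nr ns.
pose zs := undup [:: center q r s; center p r s; center p q s; center p q r].
have bzs z : z \in zs -> branch_point z.
  by rewrite mem_undup !inE => /or4P[]/eqP->; exact: center_branch.
have E x y w : ~ branch_point x -> ~ branch_point y -> ~ branch_point w ->
    center x y w \in [:: center q r s; center p r s; center p q s; center p q r] ->
    omega x y w = \sum_(z <- zs) triangle (kap z x) (kap z y) (kap z w).
  by move=> nx ny nw cz; apply: omega_sum => //; rewrite ?undup_uniq ?mem_undup.
rewrite !E ?inE ?eqxx ?orbT // -!sumrB -big_split -sumrB /= big1 // => z _.
exact: triangle_cocycle.
Qed.

Lemma app_nbranch (g : G) x : ~ branch_point x -> ~ branch_point (app g x).
Proof. by move=> nx /app_branch. Qed.

Lemma omega_inv (g : G) p q r : ~ branch_point p -> ~ branch_point q ->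
  ~ branch_point r -> omega (app g p) (app g q) (app g r) = omega p q r.
Proof.
(* The default center [b0] is not moved along with the points, so non-zero values, whose center is
   genuine, are treated first; zero values follow with [g^-1]. *)
have half (k : G) p' q' r' : ~ branch_point p' -> ~ branch_point q' ->
    ~ branch_point r' -> omega p' q' r' <> 0 ->
    omega (app k p') (app k q') (app k r') = omega p' q' r'.
  move=> np nq nr; have bz := center_branch p' q' r'.
  have [s Gs sE] := app_kap k bz; rewrite /omega -/(omega _ _ _) => t0.
  have zE x : ~ branch_point x ->
      kap (app k (center p' q' r')) (app k x) = s (kap (center p' q' r') x).
    by move=> nx; apply: sE => e; apply: nx; rewrite e.
  have E : triangle (kap (app k (center p' q' r')) (app k p'))
      (kap (app k (center p' q' r')) (app k q'))
      (kap (app k (center p' q' r')) (app k r')) =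
      triangle (kap (center p' q' r') p') (kap (center p' q' r') q')
        (kap (center p' q' r') r').
    by rewrite !zE // /triangle !(h_inv Gs).
  have bkz : branch_point (app k (center p' q' r')) by exact/app_branch.
  have [] := omega_eq (@app_nbranch k _ np) (@app_nbranch k _ nq) (@app_nbranch k _ nr) bkz.
    by rewrite E.
  by rewrite E.
move=> np nq nr; have [ om0|om0] := EM (omega p q r = 0); last exact: half.
apply: contrapT => h0; rewrite om0 in h0.
have := half (g^-1)%g _ _ _ (@app_nbranch g _ np) (@app_nbranch g _ nq) (@app_nbranch g _ nr) h0.
by rewrite !appK om0 => /esym.
Qed.

Lemma omega_bound p q r : (forall i j, `|h i j| <= 1) -> `|omega p q r| <= 3.
Proof. exact: triangle_bound. Qed.

Lemma omega_xxy p q : omega p p q = 0.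
Proof.
by apply: contrapT; rewrite /omega => /(triangle_neq h_anti)[].
Qed.

Lemma omega_xyy p q : omega p q q = 0.
Proof.
by apply: contrapT; rewrite /omega => /(triangle_neq h_anti)[].
Qed.

(** * Primitives of [omega] *)

Section Primitive.
Context (p : X) (np : ~ branch_point p) (b : G -> R).
Hypothesis bE : forall g k : G,
  b g + b k - b (g * k)%g = (omega p (app g p) (app g (app k p)))%:~R.

(** Replacing the base point [p] by the fixed point [q] turns [b] into a homomorphism on the
    stabilizer of [q], by the cocycle identity and invariance under [g]. *)
Lemma primitive_mul (q : X) (g k : G) : ~ branch_point q -> app g q = q ->
  b (g * k)%g - (omega q p (app (g * k)%g p))%:~R =
  b g - (omega q p (app g p))%:~R + (b k - (omega q p (app k p))%:~R).
Proof.
move=> nq gq; have E := bE g k.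
have co := omega_cocycle nq np (@app_nbranch g _ np) (@app_nbranch (g * k)%g _ np).
have := omega_inv g nq np (@app_nbranch k _ np); rewrite gq => inv.
rewrite appM in co *.
rewrite -inv; have {}co : (omega p (app g p) (app g (app k p)))%:~R =
    (omega q (app g p) (app g (app k p)))%:~R - (omega q p (app g (app k p)))%:~R
    + (omega q p (app g p))%:~R :> R.
  by rewrite -intrB -intrD; congr _%:~R; lia.
by lra.
Qed.

(* A swindle: [v] is a commutator in the stabilizer of [q], as it equals
   [K (t K t^-1)^-1] where [K] is the infinite product of the [t^m v t^-m],
   for some [t] pushing the support of [v] towards [q]. *)
Lemma primitive_supported (q w y : X) (v : G) : ~ branch_point q ->
  branch_point w -> y <> w -> ~ same_side w y q ->
  color_preserving (app v) -> (forall x, ~ same_side w y x -> app v x = x) ->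
  b v = (omega q p (app v p))%:~R.
Proof.
move=> nq bw yw nyq cv vout.
have qb x : branch_point x -> q <> x by move=> bx e; apply: nq; rewrite e.
have [i0 [j0 ij0]] := color_two n3.
have [y0 [by0 y0q y0w ky0q ky0w]] := kap_dense (qb _ bw) ij0.
have wy0 := nesym y0w.
have kwq : kap w q = kap w y0.
  apply: (kap_behind bw by0) => //; try exact: qb.
  by rewrite ky0q ky0w; exact: nesym.
have kwy : kap w y <> kap w y0.
  by rewrite -kwq => /(kapP bw yw (qb _ bw)).
(* Since [w1] sees [y0] in the color [kap w y0], some color-preserving map fixes [y0] and sends [w]
   to [w1]. As [e] is not [kap w y], the image of the side of [y] does not contain [w]. *)
have [e [ey ey0]] := color_other2 (kap w y) (kap w y0) n3.
have [w1 [bw1 w1y0 w1w kw1y0 kw1w]] := kap_dense y0w (nesym ey0).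
have ww1 := nesym w1w; have y0w1 := nesym w1y0.
have [t0 [ct0 t0y0 t0w]] : exists g : G,
    [/\ color_preserving (app g), app g y0 = y0 & app g w = w1].
  apply: (app_homogeneous) => //.
  apply: (kap_behind by0 bw1) => //.
  by rewrite kw1y0 kw1w; exact: nesym.
have [t [ct tin tout]] := exists_restriction w by0 ct0 t0y0.
have tw : app t w = w1 by rewrite tin //; exact: same_side_refl.
have tq : app t q = q.
  by apply: tout => /(kapP by0 wy0 (qb _ by0)); rewrite ky0w ky0q => /esym.
have tXq m : app (t ^+ m)%g q = q.
  by elim: m => // m IH; rewrite expgS appM IH.
pose wt m := app (t ^+ m)%g w; pose yt m := app (t ^+ m)%g y.
have ctX m := color_preservingX m ct.
have bwt m : branch_point (wt m) by exact/app_branch.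
have wtS m : wt m.+1 = app t (wt m) by rewrite /wt expgS appM.
(* The points [wt d] move from [w] towards [y0], and each one after [w] sees [w] in the color [e];
   hence the sides at them containing [yt d] are disjoint. *)
have away d : [/\ wt d.+1 <> w, kap (wt d.+1) w = e & kap w (wt d.+1) = kap w y0].
  elim: d => [|d [wdw kd kwd]].
    rewrite /wt expg1 tw; split=> //; apply/esym.
    apply: (kap_behind bw bw1) => //.
    by rewrite kw1y0 kw1w.
  have k1 : kap w1 (wt d.+2) = kap w y0 by rewrite wtS -tw ct // kwd.
  have w2w1 : wt d.+2 <> w1 by rewrite wtS -tw => /app_injective.
  have w2w : wt d.+2 <> w by move=> e2; move: k1; rewrite e2 kw1w.
  split=> //.
    transitivity (kap (wt d.+2) w1).
      by apply: (kap_behind (bwt _) bw1) => //; rewrite ?kw1w ?k1 //; exact: nesym.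
    by rewrite wtS -tw ct //; exact: nesym.
  transitivity (kap w w1).
    by apply: (kap_behind bw bw1) => //; rewrite ?kw1w ?k1.
  apply/esym; apply: (kap_behind bw bw1) => //.
  by rewrite kw1y0 kw1w.
have disj d x : same_side w y x -> ~ same_side (wt d.+1) (yt d.+1) x.
  move=> yx yx'; have [wdw kd kwd] := away d.
  have kx : kap w y = kap w x by apply/(kapP bw) => //; exact: same_side_neqr yx.
  have ytn : yt d.+1 <> wt d.+1 by move=> /app_injective.
  have kx' : kap w y = kap (wt d.+1) x.
    rewrite -[LHS](ctX d.+1) //; apply/(kapP (bwt _)) => //.
    exact: same_side_neqr yx'.
  have := kap_tree bw (bwt d.+1) (nesym wdw) (same_side_neqr yx) (same_side_neqr yx').
  by rewrite -kx -kx' kd kwd => -[//|/esym].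
have shift i m x : same_side (wt (m + i)%N) (yt (m + i)%N) (app (t ^+ m)%g x) <->
    same_side (wt i) (yt i) x.
  by rewrite /wt /yt expgnDr !appM; exact: app_same_side.
have disj2 i j x : same_side (wt i) (yt i) x -> same_side (wt j) (yt j) x -> i = j.
  wlog ij : i j / (i < j)%N.
    move=> H xi xj; have [ij|ji|//] := ltngtP i j; first exact: H.
    by apply/esym; exact: H.
  have -> : j = (i + (j - i).-1.+1)%N by lia.
  rewrite -(appVK (t ^+ i)%g x) -{1 2}[i]addn0 !shift /wt /yt expg0 => x0 x1.
  by case: (disj _ _ x0 x1).
pose k m := (t ^+ m * v * (t ^+ m)^-1)%g.
have ck m : color_preserving (app (k m)).
  by do 2?apply: color_preservingM => //; exact: color_preservingV.
have kw m : app (k m) (wt m) = wt m.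
  by rewrite !appM /wt appK vout // => /same_side_neqr.
have [K [cK Kin Kout]] := exists_glue bwt disj2 ck kw.
have Kq : app K q = q.
  by apply: Kout => m; have := shift 0%N m q; rewrite addn0 tXq => ->.
have vq : app v q = q by exact: vout.
have KtvtK : (K * t = v * (t * K))%g.
  apply: app_inj => x; rewrite !appM.
  have tshift i x' :
      same_side (wt i.+1) (yt i.+1) (app t x') <-> same_side (wt i) (yt i) x'.
    by have := shift i 1%N x'; rewrite expg1 add1n.
  have [tx|tx] := EM (same_side w y (app t x)).
    rewrite (Kout x) => [|i /tshift]; last exact: disj.
    by rewrite (Kin 0%N) ?expg0 ?mul1g ?invg1 ?mulg1 //; rewrite /wt /yt expg0.
  have [[i xi]|nx] := EM (exists i, same_side (wt i) (yt i) x).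
    rewrite (Kin i.+1) ?(Kin i) //; last exact/tshift.
    have kxi := side_stable (ck i) (bwt i) (kw i) xi.
    rewrite [RHS]vout; last first.
      by move=> tk; apply: (disj i _ tk); apply/tshift.
    rewrite -!appM /k; congr (app _ x).
    by rewrite !expgS !mulgA invgM !mulgA mulgVK.
  have nx' i : ~ same_side (wt i) (yt i) x by move=> xi; apply: nx; exists i.
  rewrite (Kout x) // [RHS]vout // Kout // => -[|i /tshift]; last exact: nx'.
  by rewrite /wt /yt expg0.
have tKq : app (t * K)%g q = q by rewrite appM Kq.
(* Put [f g = b g - omega q p (g p)]. Then [K * t = v * (t * K)] gives
   [f K + f t = f v + f t + f K], so [f v = 0]. *)
have e1 := primitive_mul t nq Kq; have e2 := primitive_mul K nq tq.
have e3 := primitive_mul (t * K)%g nq vq; rewrite -KtvtK in e3.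
by lra.
Qed.

End Primitive.

Lemma exists_leaf (z : X) k l : branch_point z ->
  exists t, [/\ branch_point t, t <> z, kap z t = k & kap t z = l].
Proof.
move=> bz; have [x xz kx] := kap_surj k bz.
have [l' l'l] : exists l', l' <> l by have [l' []] := color_other2 l l n3; exists l'.
have [t [bt tz tx ktz ktx]] := kap_dense (nesym xz) (nesym l'l).
exists t; split=> //; rewrite -kx; apply/esym.
apply: (kap_behind bz bt) => //; try exact: nesym.
by rewrite ktz ktx; exact: nesym.
Qed.

Lemma exists_no_primitive i j k : triangle i j k <> 0 ->
  exists2 p, ~ branch_point p & forall b : G -> R, ~ (forall g k : G,
    b g + b k - b (g * k)%g = (omega p (app g p) (app g (app k p)))%:~R).
Proof.
move=> ijk; have [ij ik jk] := triangle_neq h_anti ijk.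
(* The arc runs from [w1] to [w2]; [z] and [z'] are on it, with the colors [i], [j] in opposite
   order. At each of them, [t] or [t'] hangs off in the color [k] and sees it in the color [i]; [p]
   is behind [t], and [q1], [q2] are beyond the ends. *)
have [w2 [bw2 w21 _ _]] := exists_leaf i i bb0.
pose w1 := b0; have bw1 : branch_point w1 by [].
have w12 : w1 <> w2 by exact: nesym.
have [z [bz zw1 zw2 kzw1 kzw2]] := kap_dense w12 ij.
have [z' [bz' z'w1 z'w2 kz'w1 kz'w2]] := kap_dense w12 (nesym ij).
have [q0 qi] : exists q, q <> i by have [q []] := color_other2 i i n3; exists q.
have [t [bt tz kzt ktz]] := exists_leaf k i bz.
have [t' [bt' t'z' kz't' kt'z']] := exists_leaf k i bz'.
have [p [np pt ktp]] := exists_nonbranch q0 bt.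
have [c1 c1P] : exists q, q <> kap w1 w2.
  by have [q []] := color_other2 (kap w1 w2) (kap w1 w2) n3; exists q.
have [c2 c2P] : exists q, q <> kap w2 w1.
  by have [q []] := color_other2 (kap w2 w1) (kap w2 w1) n3; exists q.
have [q1 [nq1 q1w kq1]] := exists_nonbranch c1 bw1.
have [q2 [nq2 q2w kq2]] := exists_nonbranch c2 bw2.
have nb x q : branch_point x -> ~ branch_point q -> q <> x.
  by move=> bx nq e; apply: nq; rewrite e.
have behind (a y b : X) : branch_point a -> branch_point y -> a <> y -> b <> a ->
    b <> y -> kap y a <> kap y b -> kap a b = kap a y := @kap_behind a y b.
have far (w u s : X) : branch_point w -> branch_point u -> branch_point s ->
    w <> u -> s <> u -> kap u w <> kap u s -> kap s u = i ->
    [/\ w <> s, kap w s = kap w u & kap s w = i].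
  move=> bw bu bs wu su kus ksu; have ws : w <> s by move=> e; apply: kus; rewrite e.
  split=> //; first by apply: behind => //; exact: nesym.
  by rewrite -ksu; apply: behind => //; exact: nesym.
have e1z : kap w1 w2 = kap w1 z by apply: behind => //; try exact: nesym; congruence.
have e1z' : kap w1 w2 = kap w1 z' by apply: behind => //; try exact: nesym; congruence.
have e2z : kap w2 w1 = kap w2 z by apply: behind => //; try exact: nesym; congruence.
have e2z' : kap w2 w1 = kap w2 z' by apply: behind => //; try exact: nesym; congruence.
have [||||w1t kw1t ktw1] := far w1 z t bw1 bz bt; try exact: nesym; try congruence.
have [||||w2t kw2t ktw2] := far w2 z t bw2 bz bt; try exact: nesym; try congruence.
have [||||w1t' kw1t' kt'w1] := far w1 z' t' bw1 bz' bt'; try exact: nesym; try congruence.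
have [||||w2t' kw2t' kt'w2] := far w2 z' t' bw2 bz' bt'; try exact: nesym; try congruence.
exists p => // b bE.
(* The colors agree because [w1] and [w2] each see [t] and [t'] along the arc, and are seen from [t]
   and [t'] in the color [i]. *)
have [||a1 [ca1 a1w a1t]] := app_homogeneous
  bw1 bt bw1 bt' w1t w1t'; try congruence.
have [||a2 [ca2 a2w a2t]] := app_homogeneous
  bw2 bt bw2 bt' w2t w2t'; try congruence.
have [v [cv vin vout]] := exists_restriction w2 bw1 ca1 a1w.
have [u0 [cu0 u0in u0out]] := exists_restriction w1 bw2 ca2 a2w.
have s1t : same_side w1 w2 t by apply/(kapP bw1); try exact: nesym; congruence.
have s2t : same_side w2 w1 t by apply/(kapP bw2); try exact: nesym; congruence.
have vt : app v t = t' by rewrite vin.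
have u0t : app u0 t = t' by rewrite u0in.
have cvu : color_preserving (app (v^-1 * u0)%g).
  by apply: color_preservingM => //; exact: color_preservingV.
have vut : app (v^-1 * u0)%g t = t by rewrite appM u0t -vt appK.
(* Restricting to the side of [t] containing [z] makes [r] fix [p]; on that side [v * r] is [u0]. *)
have [r [cr rin rout]] := exists_restriction z bt cvu vut.
have ntp : ~ same_side t z p.
  by move/(kapP bt (nesym tz) pt); rewrite ktp ktz => /esym.
have rp : app r p = p by exact: rout.
pose u := (v * r)%g.
have cu : color_preserving (app u) by exact: color_preservingM.
have uout x : ~ same_side w2 w1 x -> app u x = x.
  move=> nx; have xt : x <> t by move=> e; apply: nx; rewrite e.
  have tx : same_side t z x.
    apply/(kapP bt) => //; first exact: nesym.
    rewrite ktz -ktw2; have [->//|xw2] := EM (x = w2).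
    apply/esym/behind => //; first exact: nesym.
    by rewrite kw2t -e2z => /(kapP bw2 w12 xw2).
  by rewrite appM rin // appM appVK u0out.
have n1 : ~ same_side w1 w2 q1.
  by move/(kapP bw1 (nesym w12) q1w); rewrite kq1 => /esym.
have n2 : ~ same_side w2 w1 q2.
  by move/(kapP bw2 w12 q2w); rewrite kq2 => /esym.
(* The values [b v], [b u] and [b r] are computed with the fixed points [q1], [q2] and [p]; the last
   is zero, and [bE v r] gives [b v = b u]. *)
have bv := primitive_supported np bE nq1 bw1 (nesym w12) n1 cv vout.
have bu := primitive_supported np bE nq2 bw2 w12 n2 cu uout.
have br := primitive_supported np bE np bt (nesym tz) ntp cr rout.
have up : app u p = app v p by rewrite appM rp.
have := bE v r; rewrite -/u bv bu br up !rp omega_xxy omega_xyy.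
rewrite mulr0z addr0 => /eqP; rewrite subr_eq0 eqr_int => /eqP o12.
have nvp := @app_nbranch v _ np.
have := omega_cocycle nq1 nq2 np nvp; rewrite o12.
have kt'vp : kap t' (app v p) = kap t p by rewrite -vt cv.
have vpt' : app v p <> t' by rewrite -vt => /app_injective.
have Ez : [/\ kap z q1 = i, kap z q2 = j & kap z p = k].
  split; [rewrite -kzw1|rewrite -kzw2|rewrite -kzt]; apply: behind => //;
    try exact: nesym; try exact: nb; congruence.
have Ez' : [/\ kap z' q1 = j, kap z' q2 = i & kap z' (app v p) = k].
  split; [rewrite -kz'w1|rewrite -kz'w2|rewrite -kz't']; apply: behind => //;
    try exact: nesym; try exact: nb; congruence.
(* Read off at [z], [omega q1 q2 p] is [triangle i j k]; read off at [z'], [omega q1 q2 (app v p)]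
   is [triangle j i k], its opposite. *)
case: Ez => z1 z2 z3; case: Ez' => z1' z2' z3'.
have [] := omega_eq nq1 nq2 np bz; first by rewrite z1 z2 z3.
rewrite z1 z2 z3 => -> _.
have [] := omega_eq nq1 nq2 nvp bz'; first by rewrite z1' z2' z3' (triangle_flip h_anti); lia.
rewrite z1' z2' z3' (triangle_flip h_anti) => -> _.
by lia.
Qed.

End Kaleidoscope.

(** * Signs of pairs of colors *)

Section PairOrbits.
Context {T : Type} (Gamma : subgroup (sym T)).
Notation act := (@perm_action T Gamma).

Definition same_orbit (x y : T) := exists g : Gamma, act g x = y.

Definition same_pair_orbit (a b x y : T) := exists g : Gamma, act g a = x /\ act g b = y.

Lemma same_orbit_refl x : same_orbit x x.
Proof. by exists 1%g. Qed.

Lemma same_orbit_sym x y : same_orbit x y -> same_orbit y x.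
Proof. by move=> [g <-]; exists g^-1%g; rewrite /perm_action /= sym_funK. Qed.

Lemma same_orbit_trans x y z : same_orbit x y -> same_orbit y z -> same_orbit x z.
Proof. by move=> [g <-] [k <-]; exists (k * g)%g. Qed.

(** The indicator of the orbit of the pair [(a, b)], made alternating; it vanishes identically when
    that orbit contains [(b, a)]. *)
Definition pair_sign (a b x y : T) : int :=
  (`[< same_pair_orbit a b x y >] : nat)%:Z - (`[< same_pair_orbit a b y x >] : nat)%:Z.

Lemma pair_sign_anti a b x y : pair_sign a b x y = - pair_sign a b y x.
Proof. by rewrite opprB. Qed.

Lemma pair_sign_le1 a b x y : `|pair_sign a b x y| <= 1.
Proof. by rewrite /pair_sign; do 2!case: `[< _ >]. Qed.

Lemma pair_sign_inv a b (g : Gamma) x y :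
  pair_sign a b (act g x) (act g y) = pair_sign a b x y.
Proof.
have E u v : same_pair_orbit a b (act g u) (act g v) <-> same_pair_orbit a b u v.
  split=> [[k [ku kv]]|[k [<- <-]]]; last by exists (g * k)%g.
  by exists (g^-1 * k)%g; rewrite /perm_action /= in ku kv *; rewrite ku kv !sym_funK.
by rewrite /pair_sign (asbool_equiv_eq (E x y)) (asbool_equiv_eq (E y x)).
Qed.

Lemma pair_sign_eq0 a b x y : ~ same_pair_orbit a b x y -> ~ same_pair_orbit a b y x ->
  pair_sign a b x y = 0.
Proof. by move=> h1 h2; rewrite /pair_sign !asboolF. Qed.

Lemma pair_sign_eq1 a b : ~ same_pair_orbit a b b a -> pair_sign a b a b = 1.
Proof. by move=> h; rewrite /pair_sign asboolT ?asboolF //; exists 1%g. Qed.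

Hypothesis additive : forall a b x y z,
  pair_sign a b x y + pair_sign a b y z + pair_sign a b z x = 0.

(** Otherwise [pair_sign a b] is 1 at [(a, b)] and at its image [(b, g b)], so additivity makes it
    -2 at [(g b, a)]. *)
Lemma same_orbit_swap a b : same_orbit a b -> same_pair_orbit a b b a.
Proof.
move=> [g gab]; apply: contrapT => h.
have h1 := pair_sign_eq1 h; have := pair_sign_inv a b g a b; rewrite gab h1 => h2.
have := additive a b a b (act g b); rewrite h1 h2.
by have := pair_sign_le1 a b (act g b) a; lia.
Qed.

Lemma generous_or_semi_generous : generously_transitive act \/ semi_generous act.
Proof.
have [all|] := EM (forall a b, same_orbit a b).
  by left=> x y _ _; have [g [gx gy]] := same_orbit_swap (all x y); exists g.
move=> /existsNP[a /existsNP[b nab]]; right.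
have nswap x y : ~ same_orbit x y -> ~ same_pair_orbit x y y x.
  by move=> nxy [g [gx _]]; apply: nxy; exists g.
(* With [e] in a third orbit, the three signs of the triple [a], [b], [e] would be 1, 0 and 0. *)
have two e : same_orbit a e \/ same_orbit b e.
  apply: contrapT => /not_orP[nae nbe].
  have E1 : pair_sign a b a b = 1 by apply: pair_sign_eq1; exact: nswap.
  have E2 : pair_sign a b b e = 0.
    by apply: pair_sign_eq0 => -[g [ga _]]; [apply: nab|apply: nae]; exists g.
  have E3 : pair_sign a b e a = 0.
    by apply: pair_sign_eq0 => -[g [ga gb]]; [apply: nae|apply: nbe]; exists g.
  by have := additive a b a b e; rewrite E1 E2 E3.
have orbE x y : same_orbit x y -> action_orbit act x = action_orbit act y.
  move=> xy; apply/seteqP; split=> z [g _ gz].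
    by have [k kz] := same_orbit_trans (same_orbit_sym xy) (ex_intro _ g gz);
      exists k.
  by have [k kz] := same_orbit_trans xy (ex_intro _ g gz); exists k.
have inO x y : action_orbit act x y -> same_orbit x y by move=> [g _ gy]; exists g.
have gen x : generously_transitive_on act (action_orbit act x).
  move=> y z /inO xy /inO xz.
  have [g [gy gz]] := same_orbit_swap (same_orbit_trans (same_orbit_sym xy) xz).
  by exists g.
exists (action_orbit act a), (action_orbit act b); split=> //.
- apply/seteqP; split=> O.
    by move=> [e _ <-]; case: (two e) => /orbE <-; [left|right].
  by case=> ->; [exists a|exists b].
- move=> ab; apply: nab; apply: inO; rewrite ab.
  by have [g gb] := same_orbit_refl b; exists g.
- move=> x1 x2 y1 y2 /inO ax1 /inO bx2 /inO ay1 /inO by2.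
  have apart x y : same_orbit a x -> same_orbit b y -> ~ same_orbit x y.
    move=> ax by_ xy; apply: nab; apply: same_orbit_trans ax _.
    exact: same_orbit_trans xy (same_orbit_sym by_).
  have apart' x y : same_orbit a x -> same_orbit b y -> ~ same_orbit y x.
    by move=> ax by_ /same_orbit_sym; exact: apart.
  have E1 : pair_sign x1 x2 x1 x2 = 1 by apply: pair_sign_eq1; apply/nswap/apart.
  have E2 : pair_sign x1 x2 x1 y1 = 0.
    by apply: pair_sign_eq0 => -[g [g1 g2]];
      [apply: (@apart' y1 x2)|apply: (@apart' x1 x2)] => //; exists g.
  have E3 : pair_sign x1 x2 x2 y2 = 0.
    by apply: pair_sign_eq0 => -[g [g1 g2]];
      [apply: (@apart x1 x2)|apply: (@apart x1 y2)] => //; exists g.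
  (* Additivity carries the value 1 from [(x1, x2)] to [(x1, y2)] and then to [(y1, y2)], as the
     signs within an orbit are 0. *)
  have := additive x1 x2 x1 x2 y2; have := additive x1 x2 x1 y1 y2.
  rewrite E1 E2 E3 => H1 H2; have : pair_sign x1 x2 y1 y2 = 1 by lia.
  by rewrite /pair_sign; case: asboolP => // _; case: asboolP.
Qed.

End PairOrbits.

Lemma exists_pair_sign (T : Type) (Gamma : subgroup (sym T)) :
  ~ generously_transitive (@perm_action T Gamma) ->
  ~ semi_generous (@perm_action T Gamma) ->
  exists h : T -> T -> int, [/\ forall i j, h i j = - h j i,
    forall s, subgroup_set Gamma s -> forall i j, h (s i) (s j) = h i j,
    forall i j, `|h i j| <= 1 & exists i j k, triangle h i j k <> 0].
Proof.
move=> ngen nsemi; have [a [b [i [j [k t0]]]]] :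
    exists a b i j k, triangle (pair_sign Gamma a b) i j k <> 0.
  apply: contrapT => h; case: (@generous_or_semi_generous _ Gamma) => // a b i j k.
  by apply: contrapT => h'; apply: h; exists a, b, i, j, k.
exists (pair_sign Gamma a b); split.
- exact: pair_sign_anti.
- by move=> s Gs x y; exact: (pair_sign_inv a b (exist _ s (mem_set Gs) : Gamma)).
- exact: pair_sign_le1.
- by exists i, j, k.
Qed.

(** * Integral, real and bounded cochains *)

Section Cochains.
Context {G : groupType}.

Lemma differential_real (R : realType) k (alpha : ('I_k -> G) -> int) :
  differential (real_cochain R alpha) = real_cochain R (differential alpha).
Proof.
apply/funext => x; rewrite /real_cochain /differential rmorph_sum /=.
by apply: eq_bigr => j _; rewrite rmorphM rmorphXn rmorphN1.
Qed.

(** A primitive of any of the four kinds, integral or real, bounded or not, yields a real one, so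
    the real unbounded case excludes all. *)
Lemma nontrivial_classes (R : realType) q (alpha : ('I_q.+1 -> G) -> int) :
  bounded_cocycles (q := q) alpha -> ~ coboundaries (q := q) (real_cochain R alpha) ->
  [/\ bounded_cocycles (q := q) alpha,
      nontrivial_class (q := q) alpha,
      nontrivial_bounded_class (q := q) alpha,
      nontrivial_class (q := q) (real_cochain R alpha) &
      nontrivial_bounded_class (q := q) (real_cochain R alpha)].
Proof.
move=> bc nR; have [[inv d0] [M bM]] := bc.
have cR : cocycles (q := q) (real_cochain R alpha).
  split=> [g x|]; first by rewrite /real_cochain inv.
  by rewrite differential_real d0; apply/funext => x; rewrite /real_cochain mulr0z.
have bR : bounded_cochain (real_cochain R alpha).
  exists (M%:~R) => x; rewrite /real_cochain -intr_norm ler_int; exact: bM.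
have nZ : ~ coboundaries (q := q) alpha.
  move=> [beta ibeta dbeta]; apply: nR; exists (real_cochain R beta).
    by move=> g x; rewrite /real_cochain ibeta.
  by rewrite differential_real dbeta.
split=> //; split=> //.
- by move=> [beta [ibeta _] dbeta]; apply: nZ; exists beta.
- by move=> [beta [ibeta _] dbeta]; apply: nR; exists beta.
Qed.

(** The value at [(1, g, g * k)] is the inhomogeneous differential of [b u = beta (1, u)]. *)
Lemma differential2 (A : numDomainType) (beta : ('I_2 -> G) -> A) (g k : G) :
  Defs.invariant beta -> let b u := beta (fun i => if i == 0 then 1%g else u) in
  differential beta (fun i : 'I_3 => nth 1%g [:: 1%g; g; (g * k)%g] i) =
  b g + b k - b (g * k)%g.
Proof.
move=> ib b; rewrite /differential !big_ord_recl big_ord0 /= !expr0 !mul1r addr0.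
have -> : beta (fun i => nth 1%g [:: 1%g; g; (g * k)%g] (lift ord0 i)) = b k.
  rewrite -(ib g^-1%g); congr beta; apply/funext => -[[|[|//]] h] /=.
    by rewrite mulVg.
  by rewrite mulKg.
have -> : beta (fun i => nth 1%g [:: 1%g; g; (g * k)%g] (lift (lift ord0 ord0) i))
    = b (g * k)%g.
  by congr beta; apply/funext => -[[|[|//]] h].
have -> : beta (fun i => nth 1%g [:: 1%g; g; (g * k)%g]
    (lift (lift ord0 (lift ord0 ord0)) i)) = b g.
  by congr beta; apply/funext => -[[|[|//]] h].
by rewrite /bump /= expr1 expr2; ring.
Qed.

Lemma differential3 (A : numDomainType) (w : G -> G -> G -> A) (x : 'I_4 -> G) :
  differential (fun y : 'I_3 -> G => w (y 0) (y 1) (y 2)) x =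
  w (x 1) (x 2) (x 3) - w (x 0) (x 2) (x 3) + w (x 0) (x 1) (x 3)
    - w (x 0) (x 1) (x 2).
Proof.
rewrite /differential !big_ord_recl big_ord0 /= /bump /=.
have E (j : 'I_4) (i : 'I_3) (k : 'I_4) : bump j i = k -> x (lift j i) = x k.
  by move=> h; congr x; exact: val_inj.
pose j1 : 'I_4 := lift ord0 ord0; pose j2 : 'I_4 := lift ord0 (lift ord0 ord0).
pose j3 : 'I_4 := lift ord0 (lift ord0 (lift ord0 ord0)).
rewrite (E ord0 0 1) // (E ord0 1 2) // (E ord0 2 3) //.
rewrite (E j1 0 0) // (E j1 1 2) // (E j1 2 3) //.
rewrite (E j2 0 0) // (E j2 1 1) // (E j2 2 3) //.
rewrite (E j3 0 0) // (E j3 1 1) // (E j3 2 2) //.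
by rewrite !exprS expr0; ring.
Qed.
End Cochains.

Local Close Scope ring_scope.
Local Close Scope classical_set_scope.

Theorem theorem1p6 (R : realType) (n : option nat) (X : topologicalType)
    (c : coloring n X) (Gamma : subgroup (sym (color n))) :
  at_least_3 n ->
  wazewski R n X ->
  kaleidoscopic R c ->
  ~ generously_transitive (@perm_action (color n) Gamma) ->
  ~ semi_generous (@perm_action (color n) Gamma) ->
  exists omega : ('I_3 -> kaleidoscopic_group c Gamma) -> int,
    [/\ bounded_cocycles (q:=2) omega,
        nontrivial_class (q:=2) omega,
        nontrivial_bounded_class (q:=2) omega,
        nontrivial_class (q:=2) (real_cochain R omega) &
        nontrivial_bounded_class (q:=2) (real_cochain R omega)].
Proof.
move=> n3 wX kc ngen nsemi.
have [h [h_anti h_inv h_le1 [i [j [k t0]]]]] := exists_pair_sign ngen nsemi.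
(* Any branch point serves as the default value of [center]. *)
have [e _] := exists_branch_enum n3 wX kc.
pose b0 := val (e 0%N); have bb0 : branch_point b0 by exact: set_valP.
have [p np noprim] := exists_no_primitive n3 wX kc h_anti h_inv bb0 t0.
pose w (g0 g1 g2 : kaleidoscopic_group c Gamma) : int :=
  omega c h b0 (app g0 p) (app g1 p) (app g2 p).
have nb (g : kaleidoscopic_group c Gamma) : ~ branch_point (app g p).
  exact: app_nbranch.
exists (fun x => w (x 0%R) (x 1%R) (x 2%R)); apply: nontrivial_classes.
  split; last first.
    by exists 3%R => x; exact: omega_bound.
  split=> [g x|].
    by rewrite /w !appM (omega_inv wX h_anti h_inv bb0).
  apply/funext => x; rewrite (differential3 w).
  exact: (omega_cocycle _ wX h_anti bb0).
move=> [beta ibeta dbeta].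
apply: (noprim (fun u => beta (fun i => if i == 0%R then 1%g else u))) => g1 g2.
by rewrite -differential2 // dbeta.
Qed.
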